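(* Let $T\in(0,\infty)$, let $\mathcal U\colon C([-T,0])\to\mathbb R$ be of class $C^{1,2}(\mathrm{past}\times\mathrm{present})$ and let $X=(X_t)_{t\in[0,T]}$ be a real continuous finite quadratic variation process on a probability space $(\Omega,\mathcal F,\mathbb P)$, with window process $\mathbb X$. Then the following functional Itô formula holds, $\mathbb P$-a.s., \[ \mathcal U(\mathbb X_t)=\mathcal U(\mathbb X_0)+\int_0^t D^H\mathcal U(\mathbb X_s)\,ds+\int_0^t D^V\mathcal U(\mathbb X_s)\,d^-X_s+\frac12\int_0^t D^{VV}\mathcal U(\mathbb X_s)\,d[X]_s \] for all $0\le t\le T$.
   Context: **Processes.** A real continuous process $X=(X_t)_{t\in[0,T]}$ is extended to $t\in\mathbb R$ by $X_t=X_0$ for $t\le 0$ and $X_t=X_T$ for $t\ge T$. Its window process is the $C([-T,0])$-valued process $\mathbb X_t=\{X_{t+x},\,x\in[-T,0]\}$, $t\in\mathbb R$. For a $\mathbb P$-a.s. integrable process $Y=(Y_t)_{t\in[0,T]}$, the forward integral $\int_0^\cdot Y\,d^-X$ is a continuous process which is a modification of the random function $t\mapsto\lim_{\varepsilon\to0^+}\int_0^tY_s\frac{X_{s+\varepsilon}-X_s}{\varepsilon}ds$, provided that this limit exists in probability for every $t\in[0,T]$ and such a continuous modification exists. (Asserting a formula that contains a forward integral includes asserting its existence.) $X$ is a finite quadratic variation process if $[X]_t=\lim_{\varepsilon\to0^+}\frac1\varepsilon\int_0^t(X_{s+\varepsilon}-X_s)^2ds$ exists in probability for every $t\in[0,T]$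 and the limiting random function admits a continuous version, denoted $[X]$. **Spaces.** $C([-T,0])$ is the Banach space of real continuous functions on $[-T,0]$ with the supremum norm $\|\cdot\|_\infty$. $\mathscr C([-T,0])$ is the set of bounded functions $\eta\colon[-T,0]\to\mathbb R$ that are continuous on $[-T,0)$. For $M>0$, $\mathscr C_M([-T,0])$ is the subset of functions bounded by $M$, with the topology induced by the seminorms $p_K(\eta)=\sup_{x\in K}|\eta(x)|+|\eta(0)|$, $K\subset[-T,0)$ compact. $\mathscr C([-T,0])$ carries the inductive topology, i.e. the finest topology making all inclusions $\mathscr C_M([-T,0])\to\mathscr C([-T,0])$ continuous. $C([-T,0])$ is dense in $\mathscr C([-T,0])$. $\mathscr C([-T,0))$ is the set of bounded continuous functions $\gamma\colon[-T,0)\to\mathbb R$. Every $\eta\in\mathscr C([-T,0])$ is identified with the pair $(\eta_{|[-T,0)},\eta(0))$, and for $u\colon\mathscr C([-T,0])\to\mathbb R$ one sets $\tilde u(\gamma,a)=u(\gamma1_{[-T,0)}+a1_{\{0\}})$ for $(\gamma,a)\in\mathscr C([-T,0))\times\mathbb R$. **Functional derivatives.** For $\gamma\in\mathscr C([-T,0))$ and $\varepsilon\ge0$, $\gamma(\cdot-\varepsilon)$ denotes the shifted path $x\mapsto\gamma(x-\varepsilon)$ on $[-T,0)$, with the convention $\gamma(y)=\gamma(-T)$ for $y<-T$. The horizontal derivative is \[ D^H\tilde u(\gamma,a)=\lim_{\varepsilon\to0^+}\frac{\tilde u(\gamma(\cdot),a)-\tilde u(\gamma(\cdot-\varepsilon),a)}{\varepsilon}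 \] when this limit exists and is finite, and $D^Hu(\eta)=D^H\tilde u(\eta_{|[-T,0)},\eta(0))$. The vertical derivatives are $D^Vu(\eta)=\partial_a\tilde u(\eta_{|[-T,0)},\eta(0))$ and $D^{VV}u(\eta)=\partial^2_{aa}\tilde u(\eta_{|[-T,0)},\eta(0))$. $u$ is of class $\mathscr C^{1,2}(\mathrm{past}\times\mathrm{present})$ if: (i) $u$ is continuous; (ii) $D^Hu$ exists everywhere on $\mathscr C([-T,0])$ and for every $\gamma\in\mathscr C([-T,0))$ the map $(\varepsilon,a)\mapsto D^H\tilde u(\gamma(\cdot-\varepsilon),a)$ is continuous on $[0,\infty)\times\mathbb R$; (iii) $D^Vu$ and $D^{VV}u$ exist everywhere on $\mathscr C([-T,0])$ and are continuous. $\mathcal U\colon C([-T,0])\to\mathbb R$ is of class $C^{1,2}(\mathrm{past}\times\mathrm{present})$ if it admits a (necessarily unique) extension $u\colon\mathscr C([-T,0])\to\mathbb R$ of class $\mathscr C^{1,2}(\mathrm{past}\times\mathrm{present})$; then for $\eta\in C([-T,0])$ one sets $D^H\mathcal U(\eta)=D^Hu(\eta)$, $D^V\mathcal U(\eta)=D^Vu(\eta)$, $D^{VV}\mathcal U(\eta)=D^{VV}u(\eta)$. *)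

(* Defs.v *)
From HB Require Import structures.
From mathcomp Require Import all_boot all_order all_algebra.
From mathcomp Require Import all_classical all_reals all_analysis.
Set Implicit Arguments.
Unset Strict Implicit.
Unset Printing Implicit Defensive.
Import Order.TTheory GRing.Theory Num.Theory.
Import numFieldTopology.Exports numFieldNormedType.Exports.
Local Open Scope classical_set_scope.
Local Open Scope ring_scope.

Section auxiliary.
Context {R : realType}.
Implicit Types (A B : set R) (f g : R -> R).

Lemma within_continuous_comp A B f g :
  {within B, continuous f} -> continuous g -> (forall x, A x -> B (g x)) ->
  {within A, continuous (f \o g)}.
Proof.
move=> /subspace_continuousP cf cg AB; apply/subspace_continuousP => x Ax S /=.
move=> /(cf _ (AB _ Ax)); rewrite /within/= !nbhs_simpl/= => fS.
have := cg x _ fS; rewrite !nbhs_simpl/= /within/=.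
by apply: filterS => y h /AB; exact: h.
Qed.

Lemma within_continuous_restrict A B f :
  A `<=` B -> {within A, continuous f} -> {within A, continuous (f \_ B)}.
Proof.
move=> AB; apply: subspace_eq_continuous => x; rewrite inE => Ax.
by rewrite /from_subspace /patch/= mem_set//; exact: AB.
Qed.

Lemma restrict_out A f x : ~ A x -> (f \_ A) x = 0.
Proof. by move=> Ax; rewrite /patch memNset. Qed.

Lemma normr_restrict_le A f x M :
  0 <= M -> (forall y, A y -> `|f y| <= M) -> `|(f \_ A) x| <= M.
Proof.
move=> M0 fM; have [Ax|nAx] := pselect (A x).
  by rewrite /patch mem_set//; exact: fM.
by rewrite restrict_out// normr0.
Qed.

Lemma continuous_maxl (c : R) : continuous (Num.max c).
Proof. by move=> x; apply: continuous_max; [exact: cst_continuous|exact: cvg_id]. Qed.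

Lemma continuous_minl (c : R) : continuous (Num.min c).
Proof. by move=> x; apply: continuous_min; [exact: cst_continuous|exact: cvg_id]. Qed.

End auxiliary.

(* A function on D = [-T, 0] or D = [-T, 0[ is encoded as a function R -> R
   vanishing outside D, so that Leibniz equality is equality on D. *)
Section path_spaces.
Context {R : realType} (T : {posnum R}).

Definition dom : set R := `[- T%:num, 0].
Definition past : set R := `[- T%:num, 0[.

(* C([-T, 0]) *)
Record cpath := CPath {
  cpath_fun :> R -> R ;
  cpath_out : forall x, ~ dom x -> cpath_fun x = 0 ;
  cpath_continuous : {within dom, continuous cpath_fun} }.

(* curly C([-T, 0]): bounded functions, possibly discontinuous at 0 *)
Record bpath := BPath {
  bpath_fun :> R -> R ;
  bpath_out : forall x, ~ dom x -> bpath_fun x = 0 ;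
  bpath_bounded : exists M, forall x, `|bpath_fun x| <= M ;
  bpath_continuous : {within past, continuous bpath_fun} }.

(* curly C([-T, 0[) *)
Record bpast := BPast {
  bpast_fun :> R -> R ;
  bpast_out : forall x, ~ past x -> bpast_fun x = 0 ;
  bpast_bounded : exists M, forall x, `|bpast_fun x| <= M ;
  bpast_continuous : {within past, continuous bpast_fun} }.

Lemma past_dom : past `<=` dom.
Proof. by apply: subset_itvl; rewrite bnd_simp. Qed.

Lemma cpath_is_bounded (eta : cpath) : exists M, forall x, `|eta x| <= M.
Proof.
have [M [_ hM]] : bounded_set (eta @` dom).
  apply: compact_bounded; apply: continuous_compact.
    exact: cpath_continuous.
  exact: segment_compact.
exists (Num.max 0 M + 1) => x; have M1 : M < Num.max 0 M + 1.
  by rewrite ltr_pwDr// le_max lexx orbT.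
have [Dx|nDx] := pselect (dom x); first by apply: (hM _ M1); exists x.
by rewrite cpath_out// normr0 addr_ge0// le_max lexx.
Qed.

Definition bpath_of_cpath (eta : cpath) : bpath :=
  BPath (@cpath_out eta) (cpath_is_bounded eta)
    (continuous_subspaceW past_dom (@cpath_continuous eta)).

End path_spaces.

Section past_present.
Context {R : realType} {T : {posnum R}}.

Program Definition past_of (eta : bpath T) : bpast T :=
  @BPast _ _ (eta \_ (past T)) _ _ _.
Next Obligation. by move=> eta x px; rewrite restrict_out. Qed.
Next Obligation.
move=> eta; have [M hM] := bpath_bounded eta; exists M => x.
by apply: normr_restrict_le => //; exact: le_trans (hM 0).
Qed.
Next Obligation.
by move=> eta; apply: within_continuous_restrict => //; exact: bpath_continuous.
Qed.

(* gamma 1_[-T,0[ + a 1_{0}; recall that gamma vanishes outside [-T, 0[ *)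
Program Definition glue (gamma : bpast T) (a : R) : bpath T :=
  @BPath _ _ (fun x => gamma x + a * \1_[set 0] x) _ _ _.
Next Obligation.
move=> gamma a x Dx; have -> : gamma x = 0 by apply: bpast_out => /past_dom.
rewrite indicE memNset ?mulr0 ?addr0// => /= x0; apply: Dx.
by rewrite x0 /dom /= in_itv/= lexx andbT lerNl oppr0.
Qed.
Next Obligation.
move=> gamma a; have [M hM] := bpast_bounded gamma; exists (M + `|a|) => x.
rewrite (le_trans (ler_normD _ _))// lerD// normrM ler_piMr//.
by rewrite indicE; case: (_ \in _); rewrite ?normr1 ?normr0.
Qed.
Next Obligation.
move=> gamma a; apply: subspace_eq_continuous (@bpast_continuous _ _ gamma).
move=> x; rewrite inE /past/= in_itv/= => /andP[_ x0].
rewrite /from_subspace /= indicE memNset ?mulr0 ?addr0//= => xe.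
by rewrite xe ltxx in x0.
Qed.

(* gamma(. - e), with gamma(y) = gamma(-T) for y < -T; negative shifts are
   never used and are replaced by e = 0 to make the operation total. *)
Program Definition shift (gamma : bpast T) (e : R) : bpast T :=
  @BPast _ _ ((fun x => gamma (Num.max (- T%:num) (x - Num.max 0 e)))
                \_ (past T)) _ _ _.
Next Obligation. by move=> gamma e x px; rewrite restrict_out. Qed.
Next Obligation.
move=> gamma e; have [M hM] := bpast_bounded gamma; exists M => x.
by apply: normr_restrict_le => //; exact: le_trans (hM 0).
Qed.
Next Obligation.
move=> gamma e; apply: within_continuous_restrict => //.
apply: (@within_continuous_comp _ (past T) (past T) gamma
  (Num.max (- T%:num) \o (fun x => x - Num.max 0 e))).
- exact: bpast_continuous.
- move=> x; apply: continuous_comp; last exact: continuous_maxl.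
  by apply: cvgB; [exact: cvg_id|exact: cvg_cst].
- move=> x; rewrite /past/= !in_itv/= => /andP[_ x0].
  rewrite le_max lexx/= gt_max oppr_lt0 gt0/=.
  by rewrite subr_lt0 (lt_le_trans x0)// le_max lexx.
Qed.

End past_present.

Section topology.
Context {R : realType} (T : {posnum R}).

Definition seminorm (K : set R) (f : R -> R) : R :=
  sup [set `|f x| | x in K] + `|f 0|.

Record bpathM (M : R) := BPathM {
  bpathM_val :> bpath T ;
  bpathM_le : forall x, `|bpathM_val x| <= M }.

HB.instance Definition _ (M : R) := gen_eqMixin (bpathM M).
HB.instance Definition _ (M : R) := gen_choiceMixin (bpathM M).

(* topology generated by the open balls of the seminorms p_K *)
Definition seminorm_balls (M : R) : set (set (bpathM M)) :=
  [set B | exists K (eta0 : bpathM M) (e : R),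
    [/\ compact K, K `<=` past T, 0 < e &
      B = [set eta : bpathM M | seminorm K (eta \- eta0) < e]]].

HB.instance Definition _ (M : R) :=
  isSubBaseTopological.Build (bpathM M) (@seminorm_balls M) id.

HB.instance Definition _ := gen_eqMixin (bpath T).
HB.instance Definition _ := gen_choiceMixin (bpath T).

(* finest topology making the inclusions of all bpathM M, M > 0, continuous *)
Definition inductive_open : set (set (bpath T)) :=
  [set A | forall M, 0 < M -> open (@bpathM_val M @^-1` A)].

Lemma inductive_openT : inductive_open setT.
Proof. by move=> M M0; rewrite preimage_setT; exact: openT. Qed.

Lemma inductive_openI : setI_closed inductive_open.
Proof. by move=> A B oA oB M M0; rewrite preimage_setI; apply: openI; auto. Qed.

Lemma inductive_open_bigU (I : Type) (f : I -> set (bpath T)) :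
  (forall i, inductive_open (f i)) -> inductive_open (\bigcup_i f i).
Proof.
move=> of_ M M0; rewrite preimage_bigcup; apply: bigcup_open => i _.
exact: of_.
Qed.

HB.instance Definition _ := isOpenTopological.Build (bpath T)
  inductive_openT inductive_openI inductive_open_bigU.

Lemma bpath_openE (A : set (bpath T)) : open A = inductive_open A.
Proof. by []. Qed.

End topology.

Section functional_derivatives.
Context {R : realType} {T : {posnum R}}.
Implicit Types (u : bpath T -> R) (gamma : bpast T) (a e : R) (eta : bpath T).

Definition tilde u gamma a : R := u (glue gamma a).

Definition horizontal_quotient u gamma a e : R :=
  (tilde u gamma a - tilde u (shift gamma e) a) / e.

Definition has_DHtilde u gamma a : Prop :=
  cvg (horizontal_quotient u gamma a e @[e --> 0^'+]).

Definition DHtilde u gamma a : R :=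
  lim (horizontal_quotient u gamma a e @[e --> 0^'+]).

Definition DH u eta : R := DHtilde u (past_of eta) (eta 0).

(* partial derivative in a *)
Definition dtilde u gamma a : R := derive1 (tilde u gamma) a.

Definition DV u eta : R := dtilde u (past_of eta) (eta 0).

Definition DVV u eta : R := derive1 (dtilde u (past_of eta)) (eta 0).

Record past_present_C12 u : Prop := {
  C12_continuous : continuous u ;
  C12_has_DH : forall eta, has_DHtilde u (past_of eta) (eta 0) ;
  C12_DH_continuous : forall gamma,
    {within [set p : R * R | 0 <= p.1],
      continuous (fun p => DHtilde u (shift gamma p.1) p.2)} ;
  C12_has_DV : forall eta, derivable (tilde u (past_of eta)) (eta 0) 1 ;
  C12_has_DVV : forall eta,
    derivable (dtilde u (past_of eta)) (eta 0) 1 ;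
  C12_DV_continuous : continuous (DV u) ;
  C12_DVV_continuous : continuous (DVV u) }.

Implicit Types U : cpath T -> R.

Definition C12_extension U u : Prop :=
  past_present_C12 u /\ forall eta : cpath T, u (bpath_of_cpath eta) = U eta.

Definition C12 U : Prop := exists u, C12_extension U u.

(* the extension is unique because C([-T, 0]) is dense in bpath *)
Definition extension U : bpath T -> R := xget (fun=> 0) (C12_extension U).

Definition cDH U (eta : cpath T) : R := DH (extension U) (bpath_of_cpath eta).
Definition cDV U (eta : cpath T) : R := DV (extension U) (bpath_of_cpath eta).
Definition cDVV U (eta : cpath T) : R :=
  DVV (extension U) (bpath_of_cpath eta).

End functional_derivatives.

Section processes.
Context d (Om : measurableType d) (R : realType) (T : {posnum R}).

(* real continuous processes (X_t), t in [0, T]: the values X t for t outside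
   [0, T] are irrelevant *)
Record cprocess := CProcess {
  cprocess_val :> R -> Om -> R ;
  cprocess_measurable : forall t, t \in `[0, T%:num] ->
    measurable_fun setT (cprocess_val t) ;
  cprocess_continuous : forall w,
    {within `[0, T%:num], continuous (cprocess_val ^~ w)} }.

Definition extend (X : cprocess) (t : R) (w : Om) : R :=
  X (Num.max 0 (Num.min T%:num t)) w.

Lemma extend_continuous (X : cprocess) w : continuous (extend X ^~ w).
Proof.
apply/continuous_subspace_setT.
apply: (@within_continuous_comp _ setT `[0, T%:num] (X ^~ w)
  (Num.max 0 \o Num.min T%:num)).
- exact: cprocess_continuous.
- move=> x; apply: continuous_comp; first exact: continuous_minl.
  exact: continuous_maxl.
- by move=> x _ /=; rewrite in_itv/= le_max lexx/= ge_max ge0/= ge_min lexx.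
Qed.

Program Definition window (X : cprocess) (t : R) (w : Om) : cpath T :=
  @CPath _ _ ((fun x => extend X (t + x) w) \_ (dom T)) _ _.
Next Obligation. by move=> X t w x Dx; rewrite restrict_out. Qed.
Next Obligation.
move=> X t w; apply: within_continuous_restrict => //.
apply: continuous_subspaceT => x.
apply: (@continuous_comp _ _ _ (fun x => t + x) (extend X ^~ w)).
  by apply: cvgD; [exact: cvg_cst|exact: cvg_id].
exact: extend_continuous.
Qed.

End processes.

Section integrals.
Context d (Om : measurableType d) (R : realType) (T : {posnum R}).
Variable P : probability Om R.

(* measurability is part of the definition because P is only meaningful on
   measurable sets *)
Definition cvg_in_probability (F : R -> Om -> R) (Z : Om -> R) : Prop :=
  [/\ forall e, 0 < e -> measurable_fun setT (F e),
      measurable_fun setT Z &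
      forall r, 0 < r -> P [set w | r < `|F e w - Z w|] @[e --> 0^'+] --> 0%E].

Definition qv_approx (X : cprocess Om T) (t e : R) (w : Om) : R :=
  e^-1 * \int[lebesgue_measure]_(s in `[0, t])
           (extend X (s + e) w - extend X s w) ^+ 2.

(* X is a finite quadratic variation process with [X] = Q: as limits in
   probability are defined up to null sets, requiring Q t to be a limit for
   every t says that Q is a continuous version of the limiting random
   function. The same encoding is used for the forward integral. *)
Definition is_quadratic_variation (X Q : cprocess Om T) : Prop :=
  forall t, t \in `[0, T%:num] -> cvg_in_probability (qv_approx X t) (Q t).

Definition forward_approx (Y : R -> Om -> R) (X : cprocess Om T)
    (t e : R) (w : Om) : R :=
  \int[lebesgue_measure]_(s in `[0, t])
    (Y s w * ((extend X (s + e) w - extend X s w) / e)).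

Definition is_forward_integral (Y : R -> Om -> R) (X J : cprocess Om T)
    : Prop :=
  [/\ forall t, t \in `[0, T%:num] -> measurable_fun setT (Y t),
      {ae P, forall w, lebesgue_measure.-integrable `[0, T%:num]
                         (fun s => (Y s w)%:E)} &
      forall t, t \in `[0, T%:num] ->
        cvg_in_probability (forward_approx Y X t) (J t)].

End integrals.

(* Main.v *)
Require Import Defs.
From HB Require Import structures.
From mathcomp Require Import all_boot all_order all_algebra.
From mathcomp Require Import all_classical all_reals all_analysis.
From mathcomp Require Import measurable_realfun.
From mathcomp Require Import ring lra.
Set Implicit Arguments.
Unset Strict Implicit.
Unset Printing Implicit Defensive.
Import Order.TTheory GRing.Theory Num.Theory.
Import numFieldTopology.Exports numFieldNormedType.Exports.
Local Open Scope classical_set_scope.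
Local Open Scope ring_scope.


(* For a fixed outcome, [h s a := u (gamma_s, a)], where [gamma_s] is the past
   of the window at time [s], is a function of class C^{1,2} of two real
   variables: [shift gamma_s e = gamma_(s - e)] for [e <= s <= T], so that the
   horizontal derivative is the left time derivative of [h], jointly continuous
   because it can be computed along the shifts of the single path [gamma_T].
   The formula thus reduces to a pathwise Ito formula for [h (s, X_s)]: expand
   [h (s + e, X_(s + e)) - h (s, X_s)], divide by [e], integrate over [[0, t]]
   and let [e] tend to [0] along a sequence for which the approximations of the
   quadratic variation converge at all rational times; by monotonicity they
   then converge at all times, and the integrals of continuous functions against
   them converge too. Convergence in probability is recovered from the fact that
   such a sequence exists in every set of steps accumulating at [0]. *)

(** * One-sided derivatives and Taylor expansion *)

(** The present must be able to move while the past stays put, which is why [u] has to live on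
    functions that may jump at [0]. Over [[s, s + e]] the past moves with the present held at its
    new value, then the present moves with the past held at time [s]. Hence two obstacles: the step
    is forward while the horizontal derivative only looks backward, which a mean value inequality
    for left derivatives overcomes; and that derivative is evaluated off the graph of the path, so
    that continuity along the path alone would not suffice. The forward integral is not constructed
    by hand: every other term of the divided expansion converges, so its approximations are forced
    to converge to what is left. The steps no longer occur in that remainder, so sequences along
    which the quadratic variation converges all give the same limit. *)

Section calculus.
Context {R : realType}.
Implicit Types (f g A B : R -> R) (a b s t c d e : R).

(** Only the first point is confined to [K]: the second one, such as [s + e], may leave the compact
    set. The radius is stated as eventual so that several functions can share it. *)
Lemma compact_uniform_continuity (V : pseudoMetricType R) (K : set V)
    (f : V -> R) (e : R) : compact K -> continuous f -> 0 < e ->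
  \forall d \near 0^'+, forall x y, K x -> ball x d y -> `|f x - f y| < e.
Proof.
move=> /compact_near_coveringP cK cf e0.
have /cK : forall x, K x -> \forall x' \near x & d \near (0:R)^'+,
    forall y, ball x' d y -> `|f x' - f y| < e.
  move=> x _; have /cvgrPdist_lt/(_ (e / 2)) := cf x.
  rewrite divr_gt0// => /(_ isT) /nbhs_ballP[r /= r0 fr].
  exists (ball x (r / 2), [set d | d < r / 2]) => /=.
    split; first by apply: nbhsx_ballx; rewrite divr_gt0.
    by apply: nbhs_right_lt; rewrite divr_gt0.
  move=> [x' d] /= [xx' dr] y x'y.
  have h1 : `|f x - f x'| < e / 2 by apply: fr; apply: le_ball xx'; lra.
  have h2 : `|f x - f y| < e / 2.
    apply: fr; rewrite (splitr r); apply: ball_triangle xx' _.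
    by apply: le_ball x'y; exact: ltW.
  rewrite (_ : f x' - f y = (f x - f y) - (f x - f x')); last by ring.
  by rewrite (le_lt_trans (ler_normB _ _))// (splitr e) ltrD.
by apply: filterS => d h x y Kx; exact: h.
Qed.

(* One-sided derivatives suffice: after tilting, the maximum of the function
   on the segment cannot be attained to the right of [a]. *)
Lemma left_derivative_le f D a b M : a <= b -> {within `[a, b], continuous f} ->
  (forall x, a < x <= b -> (f x - f (x - e)) / e @[e --> 0^'+] --> D x) ->
  (forall x, a < x <= b -> D x <= M) -> f b - f a <= M * (b - a).
Proof.
move=> ab cf fD DM; apply/ler_addgt0Pr => e e0.
(* The slope exceeds [M] strictly, which is what contradicts [M' <= D c]; the [+ 1] keeps the
   denominator positive when [a = b]. *)
pose M' := M + e / (b - a + 1).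
have ba : 0 < b - a + 1 by lra.
have Me : M < M' by rewrite ltrDl divr_gt0.
suff : f b - f a <= M' * (b - a).
  move=> /le_trans; apply; rewrite /M' mulrDl lerD2l mulrAC ler_pdivrMr//.
  by rewrite ler_pM2l//; lra.
have [] := @EVT_max _ (fun x => f x - M' * x) a b ab.
  move=> x; apply: continuousB; first exact: cf.
  by apply: continuous_subspaceT => y; exact: mulrl_continuous.
move=> c; rewrite in_itv/= => /andP[ac cb] cmax.
have := cmax b; rewrite in_itv/= ab lexx => /(_ isT) fbc.
have [ac'|ca] := ltP a c; last first.
  have ca' : c = a by apply/le_anti; rewrite ca.
  by rewrite ca' in fbc; rewrite mulrBr; lra.
have acb : a < c <= b by rewrite ac'.
have : M' <= D c.
  apply: (cvgr_to_ge (fD c acb)); near=> r.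
  have r0 : 0 < r by near: r; exact: nbhs_right_gt.
  have rca : r < c - a by near: r; apply: nbhs_right_lt; rewrite subr_gt0.
  have := cmax (c - r); rewrite in_itv/= ler_pdivlMr//.
  have -> : a <= c - r <= b by apply/andP; split; lra.
  by move=> /(_ isT); rewrite mulrBr; lra.
by rewrite leNgt (le_lt_trans (DM _ acb)).
Unshelve. all: by end_near. Qed.

Lemma left_derivative_dist f D a b m d : a <= b ->
  {within `[a, b], continuous f} ->
  (forall x, a < x <= b -> (f x - f (x - e)) / e @[e --> 0^'+] --> D x) ->
  (forall x, a < x <= b -> `|D x - m| <= d) ->
  `|f b - f a - m * (b - a)| <= d * (b - a).
Proof.
move=> ab cf fD Dm; rewrite ler_norml; apply/andP; split.
  have := @left_derivative_le (\- f) (\- D) a b (- (m - d)) ab.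
  have /[swap]/[apply] : {within `[a, b], continuous (\- f)}.
    by move=> x; apply: continuousN; exact: cf.
  have /[swap]/[apply] : forall x, a < x <= b ->
      ((\- f) x - (\- f) (x - e)) / e @[e --> 0^'+] --> (\- D) x.
    move=> x /fD /cvgN; apply: cvg_trans; apply: near_eq_cvg; apply: nearW => e /=.
    by rewrite -mulNr opprB opprK addrC.
  have /[swap]/[apply] : forall x, a < x <= b -> (\- D) x <= - (m - d).
    by move=> x /Dm /=; rewrite ler_norml; lra.
  by rewrite /=; lra.
have := left_derivative_le ab cf fD (_ : forall x, a < x <= b -> D x <= m + d).
have /[swap]/[apply] : forall x, a < x <= b -> D x <= m + d.
  by move=> x /Dm; rewrite ler_norml; lra.
by lra.
Qed.

Lemma mean_value f (df : R -> R) a b : (forall x : R, is_derive x 1 f (df x)) ->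
  exists2 c, `|c - a| <= `|b - a| & f b - f a = df c * (b - a).
Proof.
move=> fdf; have cf : continuous f.
  by move=> x; apply/differentiable_continuous/derivable1_diffP/ex_derive.
have [ab|/ltW ba] := leP a b.
  have [|c] := @MVT_segment _ f df a b ab (fun x _ => fdf x).
    exact: continuous_subspaceT.
  rewrite in_itv/= => /andP[ac cb] fab; exists c => //.
  by rewrite !ger0_norm ?subr_ge0// lerD2r.
have [|c] := @MVT_segment _ f df b a ba (fun x _ => fdf x).
  exact: continuous_subspaceT.
rewrite in_itv/= => /andP[bc ca] fab; exists c.
  by rewrite !ler0_norm ?subr_le0// lerN2 lerD2r.
by rewrite -opprB fab -mulrN opprB.
Qed.

Lemma taylor2_dist f (f1 f2 : R -> R) a b m d :
  (forall x : R, is_derive x 1 f (f1 x)) ->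
  (forall x : R, is_derive x 1 f1 (f2 x)) ->
  (forall x, `|x - a| <= `|b - a| -> `|f2 x - m| <= d) ->
  `|f b - f a - f1 a * (b - a) - 2^-1 * m * (b - a) ^+ 2| <= d * (b - a) ^+ 2.
Proof.
move=> ff1 f1f2 f2m.
(* Subtracting the quadratic candidate leaves two mean value steps. They yield [d] rather than the
   [d / 2] of Taylor's theorem, which is enough here. *)
pose g x := f x - f1 a * (x - a) - 2^-1 * m * (x - a) ^+ 2.
pose g1 x := f1 x - f1 a - m * (x - a).
have gg1 (x : R) : is_derive x 1 g (g1 x).
  rewrite /g; apply: is_derive_eq.
  by rewrite /g1 /GRing.scale/=; lra.
have [c ca gab] := mean_value a b gg1.
have [c1 c1a f1ac] := mean_value a c f1f2.
have -> : f b - f a - f1 a * (b - a) - 2^-1 * m * (b - a) ^+ 2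
    = (f2 c1 - m) * ((c - a) * (b - a)).
  by move: gab; rewrite /g /g1 f1ac !subrr !expr2 !mulr0 !subr0; lra.
rewrite normrM ler_pM//; first exact/f2m/(le_trans c1a).
by rewrite normrM -[leRHS]ger0_norm ?sqr_ge0// normrX expr2 ler_pM.
Qed.
End calculus.

(** * Primitives with respect to a nondecreasing function *)

Section primitive.
Context {R : realType}.
Implicit Types (f g A B : R -> R) (a b s t c d e : R).

(* [B t - B s] behaves as the integral of [f] against [dA] over [[s, t]]. With
   [A = id] this also expresses that [f] is a one-sided derivative of [B]. *)
Definition primitive_wrt A f B : Prop := forall s t c d, 0 <= s -> s <= t ->
  (forall r, s <= r <= t -> `|f r - c| <= d) ->
  `|B t - B s - c * (A t - A s)| <= d * (A t - A s).

Definition grid t (N i : nat) : R := t * i%:R / N%:R.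

Definition riemann_sum A f t (N : nat) : R :=
  \sum_(i < N) f (grid t N i) * (A (grid t N i.+1) - A (grid t N i)).

(** On cells where [f] varies by at most [d], the defining inequalities add up to the error bound.
    The mesh depends on [f], [t] and [d] only, so one [N] serves all integrators at once. *)
Lemma primitive_riemann_sum f t d : continuous f -> 0 <= t -> 0 < d ->
  \forall N \near \oo, forall A B, primitive_wrt A f B ->
    `|B t - B 0 - riemann_sum A f t N| <= d * (A t - A 0).
Proof.
move=> cf t0 d0.
have := compact_uniform_continuity (@segment_compact R 0 t) cf d0.
move=> [r /= r0 hr].
near=> N => A B AB.
have N0 : (0 < N)%N by near: N; exact: nbhs_infty_gt.
have N0' : 0 < N%:R :> R by rewrite ltr0n.
have tN : t / N%:R < r / 2.
  rewrite ltr_pdivrMr// mulrC -ltr_pdivrMr ?divr_gt0//.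
  by near: N; exact: nbhs_infty_gtr.
have -> : B t - B 0 = \sum_(i < N) (B (grid t N i.+1) - B (grid t N i)).
  rewrite -(big_mkord xpredT (fun i => B (grid t N i.+1) - B (grid t N i))).
  by rewrite telescope_sumr// /grid mulr0 mul0r mulfK ?gt_eqF.
have -> : A t - A 0 = \sum_(i < N) (A (grid t N i.+1) - A (grid t N i)).
  rewrite -(big_mkord xpredT (fun i => A (grid t N i.+1) - A (grid t N i))).
  by rewrite telescope_sumr// /grid mulr0 mul0r mulfK ?gt_eqF.
rewrite mulr_sumr /riemann_sum -sumrB (le_trans (ler_norm_sum _ _ _))//.
apply: ler_sum => i _; apply: AB.
- by rewrite /grid !mulr_ge0 ?invr_ge0.
- by rewrite /grid ler_pM2r ?invr_gt0// ler_wpM2l// ler_nat.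
move=> x /andP[ix xi]; rewrite distrC ltW//; apply: (hr (r / 2)) => //=.
- by rewrite sub0r normrN gtr0_norm; lra.
- by lra.
- rewrite /grid in_itv/= !mulr_ge0 ?invr_ge0//= ler_pdivrMr// ler_wpM2l//.
  by rewrite ler_nat ltnW.
rewrite -ball_normE /= distrC ger0_norm ?subr_ge0//.
rewrite (le_lt_trans _ tN)// lerBlDl.
by rewrite (le_trans xi)// /grid -natr1 mulrDr mulrDl mulr1.
Unshelve. all: by end_near. Qed.

(** [B i t] and [B' t] are both close to Riemann sums on one grid, and these involve the integrators
    at finitely many points only. This stands in for weak convergence of the measures [dA i]. *)
Lemma primitive_cvg f t (I : Type) (F : set_system I) (A B : I -> R -> R)
    (A' B' : R -> R) : Filter F ->
  continuous f -> 0 <= t ->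
  (forall s, 0 <= s <= t -> A i s @[i --> F] --> A' s) ->
  (\forall i \near F, primitive_wrt (A i) f (B i)) -> primitive_wrt A' f B' ->
  (forall i, B i 0 = 0) -> B' 0 = 0 ->
  B i t @[i --> F] --> B' t.
Proof.
move=> FF cf t0 AA' AB AB' B0 B'0; apply/cvgrPdist_le => e e0.
pose d := e / 3 / (`|A' t - A' 0| + 1).
have a0 : 0 < `|A' t - A' 0| + 1 by rewrite ltr_pwDr.
have d0 : 0 < d by rewrite !divr_gt0.
have [N [N0 hN]] : exists N : nat, (0 < N)%N /\
    forall A B, primitive_wrt A f B ->
    `|B t - B 0 - riemann_sum A f t N| <= d * (A t - A 0).
  have := primitive_riemann_sum cf t0 d0.
  move=> /(filterI (nbhs_infty_gt 0)) [N _ /(_ N (leqnn N))[? ?]].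
  by exists N.
have N0' : 0 < N%:R :> R by rewrite ltr0n.
have sA : riemann_sum (A i) f t N @[i --> F] --> riemann_sum A' f t N.
  apply: cvg_big => [|i _]; first exact: add_continuous.
  apply: cvgM; first exact: cvg_cst.
  have gt j : (j <= N)%N -> 0 <= grid t N j <= t.
    move=> jN; rewrite /grid !mulr_ge0 ?invr_ge0//=.
    by rewrite ler_pdivrMr// ler_wpM2l// ler_nat.
  by apply: cvgB; apply: AA'; apply: gt => //; exact: ltnW.
have tA : d * (A i t - A i 0) @[i --> F] --> d * (A' t - A' 0).
  by apply: cvgM; [exact: cvg_cst|apply: cvgB; apply: AA'; rewrite ?lexx ?t0].
have dA : d * (A' t - A' 0) < e / 2.
  rewrite /d mulrAC ltr_pdivrMr//.
  have : A' t - A' 0 <= `|A' t - A' 0| by exact: ler_norm.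
  have : e * (A' t - A' 0) <= e * `|A' t - A' 0|.
    by rewrite ler_pM2l// ler_norm.
  have : 0 <= e * `|A' t - A' 0| by rewrite mulr_ge0 // ltW.
  lra.
near=> i.
have h1 : `|riemann_sum A' f t N - riemann_sum (A i) f t N| <= e / 6.
  by near: i; move/cvgrPdist_le : sA; apply; rewrite divr_gt0.
have h2 : d * (A i t - A i 0) <= e / 3.
  near: i; apply: cvgr_le tA _ _.
  rewrite /d mulrAC ltr_pdivrMr//.
  have : e * (A' t - A' 0) <= e * `|A' t - A' 0|.
    by rewrite ler_pM2l// ler_norm.
  lra.
have h4 : d * (A' t - A' 0) <= e / 3.
  rewrite /d mulrAC ler_pdivrMr//.
  have : e * (A' t - A' 0) <= e * `|A' t - A' 0|.
    by rewrite ler_pM2l// ler_norm.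
  lra.
have /hN : primitive_wrt (A i) f (B i) by near: i.
have := hN _ _ AB'; rewrite B0 B'0 !subr0.
move: h1 h2 h4; rewrite !ler_norml => /andP[? ?] ? ? /andP[? ?] /andP[? ?].
apply/andP; split; lra.
Unshelve. all: by end_near. Qed.

(** A constant sequence converges to itself and, by [primitive_cvg], to the other primitive. *)
Lemma primitive_unique f A B B' t : continuous f -> 0 <= t ->
  primitive_wrt A f B -> primitive_wrt A f B' -> B 0 = 0 -> B' 0 = 0 ->
  B t = B' t.
Proof.
move=> cf t0 AB AB' B0 B'0.
have F s : 0 <= s <= t -> A s @[_ --> \oo] --> A s by move=> _; exact: cvg_cst.
have /cvg_lim <- // : B t @[_ --> \oo] --> B' t; last by rewrite lim_cst.
exact: (@primitive_cvg f t nat \oo (fun=> A) (fun=> B) A B' _ cf t0 F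
  (nearW _ (fun=> AB)) AB' (fun=> B0) B'0).
Qed.

(** With [c = 0] and [d] a bound of [f], the increments of [B] are dominated by those of [A]. *)
Lemma primitive_continuous f A B T : 0 <= T -> continuous f ->
  {within `[0, T], continuous A} -> primitive_wrt A f B ->
  {within `[0, T], continuous B}.
Proof.
move=> T0 cf cA AB.
have [M fM] : exists M, forall s, 0 <= s <= T -> `|f s| <= M.
  have [|c _ hc] := @EVT_max _ (fun x => `|f x|) 0 T T0.
    by apply: continuous_subspaceT => x; exact/continuous_comp/norm_continuous/cf.
  by exists `|f c| => s sT; apply: hc; rewrite in_itv.
have BA s t : 0 <= s -> s <= t -> t <= T -> `|B t - B s| <= M * `|A t - A s|.
  move=> s0 st tT; have := AB s t 0 M s0 st.
  rewrite mul0r subr0 => /(_ _)/le_trans; apply.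
    by move=> r /andP[sr rt]; rewrite subr0 fM// (le_trans s0 sr) (le_trans rt tT).
  rewrite ler_wpM2l ?ler_norm//.
  by rewrite (le_trans (normr_ge0 (f 0)))// fM// lexx.
have M0 : 0 <= M by rewrite (le_trans (normr_ge0 (f 0)))// fM// lexx.
apply/subspace_continuousP => x /=; rewrite in_itv/= => /andP[x0 xT].
apply/cvgrPdist_le => e e0.
move/subspace_continuousP : cA => /(_ x); rewrite /= in_itv/= x0 xT => /(_ isT).
have e' : 0 < e / (M + 1) by rewrite divr_gt0// ltr_pwDr.
move=> /cvgrPdist_le/(_ _ e'); rewrite !near_withinE.
apply: filterS => y + /[dup] yT => /[apply]; move: yT; rewrite /= in_itv/= => /andP[y0 yT].
move=> Axy; apply: (@le_trans _ _ (M * (e / (M + 1)))); last first.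
  rewrite mulrCA ler_piMr ?(ltW e0)// ler_pdivrMr ?ltr_pwDr//.
  by rewrite mul1r lerDl.
have [xy|/ltW yx] := leP x y.
  rewrite distrC (le_trans (BA _ _ x0 xy yT))// ler_wpM2l//.
  by rewrite distrC.
by rewrite (le_trans (BA _ _ y0 yx xT))// ler_wpM2l.
Qed.

(* The averages of [v (s + e) - v s] are computed through a primitive of [v],
   which makes a change of variable unnecessary. *)
Lemma primitive_shift f B e : 0 <= e -> primitive_wrt id f B ->
  primitive_wrt id (fun s => f (s + e)) (fun s => B (s + e) - B e).
Proof.
move=> e0 fB s t c d s0 st fc /=.
have := fB (s + e) (t + e) c d; rewrite addr_ge0// lerD2r => /(_ isT st).
have -> : B (t + e) - B e - (B (s + e) - B e) = B (t + e) - B (s + e) by ring.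
have -> : t + e - (s + e) = t - s by ring.
apply => r /andP[sr rt]; rewrite -(subrK e r); apply: fc.
by apply/andP; split; lra.
Qed.

Lemma primitive_right_derivative f B t : continuous f -> 0 <= t ->
  primitive_wrt id f B ->
  (B (t + e) - B t) / e @[e --> 0^'+] --> f t.
Proof.
move=> cf t0 fB; apply/cvgrPdist_le => d d0.
have := compact_uniform_continuity (@compact_set1 _ t) cf d0.
move=> [r /= r0 hr].
near=> e.
have e0 : 0 < e by near: e; exact: nbhs_right_gt.
have er : e < r / 2 by near: e; apply: nbhs_right_lt; rewrite divr_gt0.
have := fB t (t + e) (f t) d t0; rewrite lerDl (ltW e0) => /(_ isT).
have -> : t + e - t = e by ring.
have -> : f t - (B (t + e) - B t) / e = - ((B (t + e) - B t - f t * e) / e).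
  by field; rewrite gt_eqF.
rewrite normrN normrM normfV (gtr0_norm e0) ler_pdivrMr//.
apply => x /andP[tx xt]; rewrite distrC ltW//; apply: (hr (r / 2)) => //=.
- by rewrite sub0r normrN gtr0_norm; lra.
- by lra.
by rewrite -ball_normE /= distrC ger0_norm ?subr_ge0//; lra.
Unshelve. all: by end_near. Qed.

End primitive.

(** * Lebesgue and Lebesgue-Stieltjes integrals *)

Section integral_primitive.
Context {R : realType} (mu : {measure set (measurableTypeR R) -> \bar R}).
Hypothesis mu_fin : forall a b : R, (mu [set` `[a, b]] < +oo)%E.
Implicit Types (f q : R -> R) (s t : R).

Lemma continuous_integrable f a b : continuous f ->
  mu.-integrable [set` `[a, b]] (EFin \o f).
Proof.
move=> cf; apply: (@measurable_bounded_integrable _ _ _ mu f) => //.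
- apply: measurable_funTS; exact: continuous_measurable_fun.
- have /compact_bounded[M [_ fM]] := continuous_compact
    (continuous_subspaceT cf) (@segment_compact R a b).
  by exists M; split; rewrite ?num_real// => e Me x abx; apply: fM.
Qed.

Lemma Rintegral_itv_split f s t : continuous f -> 0 <= s -> s <= t ->
  \int[mu]_(x in `[0, t]) f x
  = \int[mu]_(x in `[0, s]) f x + \int[mu]_(x in `]s, t]) f x.
Proof.
move=> cf s0 st.
have E : [set` `[0, t]] = [set` `[0, s]] `|` [set` `]s, t]] :> set R.
  by rewrite -itv_bndbnd_setU// bnd_simp.
rewrite {1}E Rintegral_setU//.
- by rewrite -E; exact: continuous_integrable.
- rewrite disj_set2E; apply/eqP/seteqP; split => x //=.
  by rewrite !in_itv/= => -[/andP[_ xs] /andP[sx _]]; lra.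
Qed.

(** The density [q] lets one statement cover all uses: Lebesgue measure with [q = 1] or with scaled
    squared increments, and Stieltjes measure with [q = 1]. *)
Lemma primitive_Rintegral f q : continuous f -> continuous q ->
  (forall x, 0 <= q x) ->
  primitive_wrt (fun t => \int[mu]_(x in `[0, t]) q x) f
                (fun t => \int[mu]_(x in `[0, t]) (f x * q x)).
Proof.
move=> cf cq q0 s t c d s0 st fc.
have cfq : continuous (fun x => f x * q x).
  by move=> x; apply: cvgM; [exact: cf|exact: cq].
rewrite (Rintegral_itv_split cq s0 st) (Rintegral_itv_split cfq s0 st).
rewrite ![X in `|X|](_ : _ - _ = \int[mu]_(x in `]s, t]) (f x * q x)
  - c * \int[mu]_(x in `]s, t]) q x); last by ring.
rewrite [in leRHS]addrAC subrr add0r.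
have sub : ([set` `]s, t]] : set (measurableTypeR R)) `<=` [set` `[s, t]].
  by apply: subset_itvr; rewrite bnd_simp.
have ii (g : R -> R) : continuous g -> mu.-integrable `]s, t] (EFin \o g).
  by move=> cg; apply: integrableS sub _ => //; exact: continuous_integrable.
rewrite -!RintegralZl//; try exact: ii.
have ccq k : continuous (fun x => k * q x).
  by move=> x; apply: cvgM; [exact: cvg_cst|exact: cq].
rewrite -RintegralB//; try exact: ii.
have cd : continuous (fun x => f x * q x - c * q x).
  by move=> x; apply: cvgB; [exact: cfq|exact: ccq].
rewrite (le_trans (le_normr_Rintegral _ _))//; first exact: ii.
apply: le_Rintegral => //.
- by apply: ii => x; apply: cvg_norm; exact: cd.
- exact: ii.
move=> x; rewrite /= in_itv/= => /andP[sx xt].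
by rewrite -mulrBl normrM (ger0_norm (q0 x)) ler_wpM2r// fc// xt ltW.
Qed.

Hypothesis mu0 : mu [set 0] = 0%E.

Lemma Rintegral_itv00 f : \int[mu]_(x in `[0, 0]) f x = 0.
Proof.
rewrite set_itv1 /Rintegral null_set_integral//.
by apply/measurable_EFinP; exact: measurable_fun_set1.
Qed.

End integral_primitive.

Section lebesgue_stieltjes.
Context {R : realType}.

Lemma lebesgue_itv_fin (a b : R) : (@lebesgue_measure R [set` `[a, b]] < +oo)%E.
Proof. by rewrite lebesgue_measure_itv/=; case: ifP => // _; rewrite -EFinB ltry. Qed.

Lemma lebesgue_set0 : @lebesgue_measure R [set 0] = 0%E.
Proof. exact: lebesgue_measure_set1. Qed.

Lemma Rintegral_lebesgue_cst (t : R) : 0 <= t ->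
  \int[lebesgue_measure]_(x in `[0, t]) (1:R) = t.
Proof.
move=> t0; rewrite Rintegral_cst//= mul1r lebesgue_measure_itv/= lte_fin.
by case: ltP => //= [_|t0']; [rewrite subr0|apply/le_anti; rewrite t0].
Qed.

Variable G : cumulative R R.
Hypothesis GN : G (-1) = G 0.

Lemma lebesgue_stieltjes_ocitv (a b : R) : a <= b ->
  lebesgue_stieltjes_measure G [set` `]a, b]] = (G b - G a)%:E.
Proof.
move=> ab; rewrite /lebesgue_stieltjes_measure /measure_extension.
by rewrite measurable_mu_extE/= ?wlength_itv_bnd//; exact: is_ocitv.
Qed.

Lemma lebesgue_stieltjes_itv_fin (a b : R) :
  (lebesgue_stieltjes_measure G [set` `[a, b]] < +oo)%E.
Proof.
have [ab|ba] := leP a b; last by rewrite set_itv_ge ?measure0// bnd_simp -ltNge.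
rewrite (@le_lt_trans _ _ (lebesgue_stieltjes_measure G [set` `]a - 1, b]]))//.
  apply: le_measure; rewrite ?inE//.
  by apply: subset_itvr; rewrite bnd_simp; lra.
by rewrite lebesgue_stieltjes_ocitv ?ltry//; lra.
Qed.

(** Integrals over [[0, t]] would count an atom at [0]; it would lie in []-1, 0]], whose mass
    vanishes by [GN]. *)
Lemma lebesgue_stieltjes_set0 : lebesgue_stieltjes_measure G [set 0] = 0%E.
Proof.
apply/eqP; rewrite eq_le measure_ge0 andbT.
rewrite (@le_trans _ _ (lebesgue_stieltjes_measure G [set` `]-1, 0]]))//.
  apply: le_measure; rewrite ?inE//=.
  by move=> x /= ->; rewrite in_itv/= lexx andbT; lra.
by rewrite lebesgue_stieltjes_ocitv ?GN ?subrr//; lra.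
Qed.

Lemma Rintegral_stieltjes_cst (t : R) : 0 <= t ->
  \int[lebesgue_stieltjes_measure G]_(x in `[0, t]) (1:R) = G t - G 0.
Proof.
move=> t0; have c1 : continuous (fun _ : R => 1 : R) by move=> x; exact: cvg_cst.
rewrite (Rintegral_itv_split lebesgue_stieltjes_itv_fin c1 (lexx 0) t0).
rewrite (Rintegral_itv00 lebesgue_stieltjes_set0) add0r.
by rewrite Rintegral_cst//= mul1r lebesgue_stieltjes_ocitv.
Qed.

End lebesgue_stieltjes.

(** * The Ito formula for a deterministic path *)

Section lebesgue_on_segment.
Context {R : realType}.
Implicit Types (f g v : R -> R) (t e : R).

Lemma lebesgue_continuous_integrable f t : continuous f ->
  lebesgue_measure.-integrable `[0, t] (EFin \o f).
Proof. by move=> cf; apply: continuous_integrable => //; exact: lebesgue_itv_fin. Qed.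

Lemma primitive_lebesgue f : continuous f ->
  primitive_wrt id f (fun t => \int[lebesgue_measure]_(s in `[0, t]) f s).
Proof.
move=> cf.
have c1 : continuous (fun _ : R => 1 : R) by move=> x; exact: cvg_cst.
have := primitive_Rintegral lebesgue_itv_fin cf c1 (fun=> ler01).
move=> P s t c d s0 st fc; have := P s t c d s0 st fc.
rewrite !Rintegral_lebesgue_cst//; last exact: le_trans st.
under eq_Rintegral do rewrite mulr1.
by under [X in _ - X - _]eq_Rintegral do rewrite mulr1.
Qed.

(** The integral is the average of [v] over [[t, t + e]] minus its average over [[0, e]], and each
    average tends to the value at the left endpoint. *)
Lemma mean_increment_cvg v t : continuous v -> 0 <= t ->
  \int[lebesgue_measure]_(s in `[0, t]) ((v (s + e) - v s) / e)
    @[e --> 0^'+] --> v t - v 0.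
Proof.
move=> cv t0; pose W t := \int[lebesgue_measure]_(s in `[0, t]) v s.
have PW : primitive_wrt id v W by exact: primitive_lebesgue.
have W0 : W 0 = 0 by apply: Rintegral_itv00; exact: lebesgue_set0.
have L : (W (t + e) - W t) / e - (W (0 + e) - W 0) / e @[e --> 0^'+]
    --> v t - v 0.
  by apply: cvgB; exact: primitive_right_derivative.
apply: cvg_trans L; apply: near_eq_cvg; near=> e.
have e0 : 0 < e by near: e; exact: nbhs_right_gt.
have cve : continuous (fun s => v (s + e)).
  move=> s; apply: (@continuous_comp _ _ _ (fun s => s + e) v); last exact: cv.
  by apply: cvgD; [exact: cvg_id|exact: cvg_cst].
rewrite /= RintegralZr//; last first.
  by apply: lebesgue_continuous_integrable => s; apply: cvgB; [exact: cve|exact: cv].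
rewrite RintegralB//; try exact: lebesgue_continuous_integrable.
have -> : \int[lebesgue_measure]_(s in `[0, t]) v (s + e) = W (t + e) - W e.
  apply: (@primitive_unique _ _ id _ (fun t => W (t + e) - W e) t cve t0
    (primitive_lebesgue cve)); [by apply: primitive_shift => //; exact: ltW| |].
    by apply: Rintegral_itv00; exact: lebesgue_set0.
  by rewrite add0r subrr.
by rewrite add0r W0 subr0 -/(W t); ring.
Unshelve. all: by end_near. Qed.

End lebesgue_on_segment.

Lemma continuous_pair (U V W : topologicalType) (f : U -> V) (g : U -> W) :
  continuous f -> continuous g -> continuous (fun x => (f x, g x)).
Proof. by move=> cf cg x; exact: (cvg_pair (cf x) (cg x)). Qed.

Section ito.
Context {R : realType} (T : R) (xi : R -> R) (h H h1 h2 : R -> R -> R).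
Implicit Types (s t a d e : R).
Hypothesis cxi : continuous xi.
Hypothesis ch : continuous (fun p : R * R => h p.1 p.2).
Hypothesis cH : continuous (fun p : R * R => H p.1 p.2).
Hypothesis ch1 : continuous (fun p : R * R => h1 p.1 p.2).
Hypothesis ch2 : continuous (fun p : R * R => h2 p.1 p.2).
Hypothesis hH : forall a, primitive_wrt id (H ^~ a) (h ^~ a).
Hypothesis hh1 : forall s a : R, 0 <= s <= T -> is_derive a 1 (h s) (h1 s a).
Hypothesis h1h2 : forall s a : R, 0 <= s <= T -> is_derive a 1 (h1 s) (h2 s a).

Lemma continuous_along (k : R -> R -> R) :
  continuous (fun p : R * R => k p.1 p.2) -> continuous (fun s => k s (xi s)).
Proof.
move=> ck s; apply: (@continuous_comp _ _ _ (fun s => (s, xi s))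
  (fun p : R * R => k p.1 p.2)); last exact: ck.
by apply: continuous_pair => [x|]; [exact: cvg_id|exact: cxi].
Qed.

(** Time moves first, at the new present [xi (s + e)], so that the Taylor expansion in the present
    takes place at a time [s <= T], where the derivatives are available; only [hH] reaches beyond
    [T]. *)
Lemma increment_expansion d : 0 < d ->
  \forall e \near 0^'+, forall s, 0 <= s <= T ->
    `|h (s + e) (xi (s + e)) - h s (xi s) - e * H s (xi s)
      - h1 s (xi s) * (xi (s + e) - xi s)
      - 2^-1 * h2 s (xi s) * (xi (s + e) - xi s) ^+ 2|
    <= d * (e + (xi (s + e) - xi s) ^+ 2).
Proof.
(* [K] is the graph of the path, compact in the plane. The radius [r] works around the whole graph,
   and [r1] will keep [xi (s + e)] within [r] of [xi s]. *)
move=> d0; pose K := (fun s => (s, xi s)) @` `[0, T].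
have cK : compact K.
  apply: continuous_compact; last exact: segment_compact.
  apply: continuous_subspaceT => s.
  by apply: continuous_pair => [x|]; [exact: cvg_id|exact: cxi].
have [r [r0 rH rh2]] : exists r, [/\ 0 < r,
    forall x y, K x -> ball x r y -> `|H x.1 x.2 - H y.1 y.2| < d &
    forall x y, K x -> ball x r y -> `|h2 x.1 x.2 - h2 y.1 y.2| < d].
  near (0:R)^'+ => r; exists r; split; near: r; first exact: nbhs_right_gt.
    exact: (compact_uniform_continuity cK cH).
  exact: (compact_uniform_continuity cK ch2).
have [r1 [r10 rxi]] : exists r1, 0 < r1 /\
    forall x y, `[0, T]%classic x -> ball x r1 y -> `|xi x - xi y| < r.
  near (0:R)^'+ => r1; exists r1; split; near: r1; first exact: nbhs_right_gt.
  exact: (compact_uniform_continuity (@segment_compact R 0 T) cxi).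
near=> e => s sT.
have e0 : 0 < e by near: e; exact: nbhs_right_gt.
have er : e < r by near: e; exact: nbhs_right_lt.
have [s0 _] := andP sT.
have Ks : K (s, xi s) by exists s.
have er1 : e < r1 by near: e; exact: nbhs_right_lt.
have Dr : `|xi (s + e) - xi s| < r.
  rewrite distrC; apply: rxi; first by rewrite /= in_itv.
  by rewrite -ball_normE /= opprD addrA subrr sub0r normrN gtr0_norm.
have E1 : `|h (s + e) (xi (s + e)) - h s (xi (s + e)) - H s (xi s) * e| <= d * e.
  have := @hH (xi (s + e)) s (s + e) (H s (xi s)) d s0.
  rewrite lerDl (ltW e0) => /(_ isT); rewrite /= (_ : s + e - s = e); last by ring.
  apply => x /andP[sx xs]; rewrite distrC ltW//.
  apply: (rH (s, xi s) (x, _)) => //; split => /=; rewrite -ball_normE /=.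
    by rewrite distrC ger0_norm ?subr_ge0//; lra.
  by rewrite distrC.
have E2 := @taylor2_dist _ (h s) (h1 s) (h2 s) (xi s) (xi (s + e)) (h2 s (xi s)) d
  (fun a => hh1 a sT) (fun a => h1h2 a sT) _.
have {}E2 : `|h s (xi (s + e)) - h s (xi s) - h1 s (xi s) * (xi (s + e) - xi s)
    - 2^-1 * h2 s (xi s) * (xi (s + e) - xi s) ^+ 2| <= d * (xi (s + e) - xi s) ^+ 2.
  apply: E2 => x xs; rewrite distrC ltW//.
  apply: (rh2 (s, xi s) (s, x)) => //; split => /=; rewrite -ball_normE /=.
    by rewrite subrr normr0.
  by rewrite distrC (le_lt_trans xs).
rewrite [leRHS]mulrDr; apply: (le_trans _ (lerD E1 E2)).
apply: (le_trans _ (ler_normD _ _)).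
by rewrite le_eqVlt; apply/orP; left; apply/eqP; congr `|_|; ring.
Unshelve. all: by end_near. Qed.

(** In the integrated and divided expansion, the increments of [h] tend to boundary values and the
    second-order term converges by [primitive_cvg]; the forward term is the only one left. *)
Lemma forward_integral_cvg (e_ : nat -> R) (A B : R -> R) t : 0 <= t <= T ->
  e_ n @[n --> \oo] --> 0^'+ ->
  (forall s, 0 <= s <= t ->
    (e_ n)^-1 * \int[lebesgue_measure]_(r in `[0, s]) (xi (r + e_ n) - xi r) ^+ 2
      @[n --> \oo] --> A s) ->
  primitive_wrt A (fun s => h2 s (xi s)) B -> B 0 = 0 ->
  \int[lebesgue_measure]_(s in `[0, t])
      (h1 s (xi s) * ((xi (s + e_ n) - xi s) / e_ n)) @[n --> \oo] -->
  h t (xi t) - h 0 (xi 0) - \int[lebesgue_measure]_(s in `[0, t]) H s (xi s)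
    - 2^-1 * B t.
Proof.
move=> /andP[t0 tT] e0 eA AB B0.
have cv := continuous_along ch; have cHx := continuous_along cH.
have ch1x := continuous_along ch1; have ch2x := continuous_along ch2.
(* The density of the approximate quadratic variation: divided by [e_ n], the error bound of the
   expansion becomes [d * (1 + q n s)]. *)
pose q n s := (e_ n)^-1 * (xi (s + e_ n) - xi s) ^+ 2.
have cD n : continuous (fun s => xi (s + e_ n) - xi s).
  move=> s; apply: cvgB; last exact: cxi.
  apply: (@continuous_comp _ _ _ (fun s => s + e_ n) xi); last exact: cxi.
  by apply: cvgD; [exact: cvg_id|exact: cvg_cst].
have cD2 n : continuous (fun s => (xi (s + e_ n) - xi s) ^+ 2).
  move=> s; apply: (@continuous_comp _ _ _ (fun s => xi (s + e_ n) - xi s)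
    (fun x => x ^+ 2)); [exact: cD|exact: exprn_continuous].
have cq n : continuous (q n).
  by move=> s; apply: cvgM; [exact: cvg_cst|exact: cD2].
pose I g := \int[lebesgue_measure]_(s in `[0, t]) g s.
have qA s : 0 <= s <= t ->
    \int[lebesgue_measure]_(r in `[0, s]) q n r @[n --> \oo] --> A s.
  move=> /eA; apply: cvg_trans; apply: near_eq_cvg; apply: nearW => n /=.
  rewrite /q RintegralZl//; exact: lebesgue_continuous_integrable.
have e_gt0 : \forall n \near \oo, 0 < e_ n.
  exact: e0 _ (nbhs_right_gt 0).
have cc (k : R) : continuous (fun _ : R => k) by move=> s; exact: cvg_cst.
have cB (f g : R -> R) : continuous f -> continuous g ->
    continuous (fun s => f s - g s).
  by move=> cf cg s; apply: cvgB; [exact: cf|exact: cg].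
have cM (f g : R -> R) : continuous f -> continuous g ->
    continuous (fun s => f s * g s).
  by move=> cf cg s; apply: cvgM; [exact: cf|exact: cg].
have IB (f g : R -> R) : continuous f -> continuous g ->
    I (fun s => f s - g s) = I f - I g.
  by move=> cf cg; rewrite /I RintegralB//; exact: lebesgue_continuous_integrable.
have IZ (k : R) (f : R -> R) : continuous f -> I (fun s => k * f s) = k * I f.
  by move=> cf; rewrite /I RintegralZl//; exact: lebesgue_continuous_integrable.
have h2q : I (fun s => h2 s (xi s) * q n s) @[n --> \oo] --> B t.
  apply: (@primitive_cvg _ (fun s => h2 s (xi s)) t nat \oo
    (fun n s => \int[lebesgue_measure]_(r in `[0, s]) q n r)
    (fun n s => \int[lebesgue_measure]_(r in `[0, s]) (h2 r (xi r) * q n r))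
    A B) => //.
    near=> n; apply: primitive_Rintegral => //; first exact: lebesgue_itv_fin.
    move=> x; rewrite /q mulr_ge0 ?sqr_ge0// invr_ge0 ltW//.
    by near: n.
  by move=> n; apply: Rintegral_itv00; exact: lebesgue_set0.
have vL : I (fun s => (h (s + e_ n) (xi (s + e_ n)) - h s (xi s)) / e_ n)
    @[n --> \oo] --> h t (xi t) - h 0 (xi 0).
  by have := mean_increment_cvg cv t0; apply: cvg_comp.
pose S n := I (fun s => (h (s + e_ n) (xi (s + e_ n)) - h s (xi s)) / e_ n)
  - I (fun s => H s (xi s)) - 2^-1 * I (fun s => h2 s (xi s) * q n s).
have SL : S n @[n --> \oo] --> h t (xi t) - h 0 (xi 0)
    - \int[lebesgue_measure]_(s in `[0, t]) H s (xi s) - 2^-1 * B t.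
  apply: cvgB; first by apply: cvgB => //; exact: cvg_cst.
  by apply: cvgM => //; exact: cvg_cst.
apply: (cvg_sub0 _ SL); apply/cvgrPdist_le => r r0.
(* For large [n] the integral of [1 + q n s] over [[0, t]] is at most this denominator, so the total
   error is at most [r]. *)
pose d := r / (t + `|A t| + 1).
have d0 : 0 < d by rewrite divr_gt0// ltr_pwDr// addr_ge0.
have AtB : \forall n \near \oo,
    \int[lebesgue_measure]_(r in `[0, t]) q n r <= `|A t| + 1.
  have /cvgr_le : \int[lebesgue_measure]_(r in `[0, t]) q n r @[n --> \oo] --> A t.
    by apply: qA; rewrite t0 lexx.
  by apply; rewrite (le_lt_trans (ler_norm _))// ltrDl.
have expansion : \forall n \near \oo, forall s, 0 <= s <= T ->
    `|h (s + e_ n) (xi (s + e_ n)) - h s (xi s) - e_ n * H s (xi s)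
      - h1 s (xi s) * (xi (s + e_ n) - xi s)
      - 2^-1 * h2 s (xi s) * (xi (s + e_ n) - xi s) ^+ 2|
    <= d * (e_ n + (xi (s + e_ n) - xi s) ^+ 2).
  exact: e0 _ (increment_expansion d0).
move: e_gt0 AtB expansion; apply: filterS3 => n en0 An expansion.
have cve : continuous (fun s => (h (s + e_ n) (xi (s + e_ n)) - h s (xi s)) / e_ n).
  move=> s; apply: cvgM; last exact: cvg_cst; apply: cvgB; last exact: cv.
  apply: (@continuous_comp _ _ _ (fun s => s + e_ n) (fun s => h s (xi s))).
    by apply: cvgD; [exact: cvg_id|exact: cvg_cst].
  exact: cv.
have ch2q : continuous (fun s => h2 s (xi s) * q n s) by exact: cM.
have ch2q' : continuous (fun s => 2^-1 * (h2 s (xi s) * q n s)) by exact: cM.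
have ch1D : continuous (fun s => h1 s (xi s) * ((xi (s + e_ n) - xi s) / e_ n)).
  by apply: (cM) => //; exact: cM.
have c1 := cB _ _ cve cHx; have c2 := cB _ _ c1 ch2q'; have c3 := cB _ _ c2 ch1D.
have c4 : continuous (fun s => 1 + q n s).
  by move=> s; apply: cvgD; [exact: cvg_cst|exact: cq].
have -> : (0 - ((fun n => \int[lebesgue_measure]_(s in `[0, t])
      (h1 s (xi s) * ((xi (s + e_ n) - xi s) / e_ n))) - S) n)
  = I (fun s => (h (s + e_ n) (xi (s + e_ n)) - h s (xi s)) / e_ n - H s (xi s)
      - 2^-1 * (h2 s (xi s) * q n s)
      - h1 s (xi s) * ((xi (s + e_ n) - xi s) / e_ n)).
  by rewrite ?fctE IB// IB// IB// IZ// /S /I /=; ring.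
rewrite (le_trans (le_normr_Rintegral _ _))//.
  exact: lebesgue_continuous_integrable.
apply: (@le_trans _ _ (I (fun s => d * (1 + q n s)))).
  apply: le_Rintegral => //.
  - apply: lebesgue_continuous_integrable => s; apply: cvg_norm; exact: c3.
  - by apply: lebesgue_continuous_integrable; exact: (cM _ _ (cc d) c4).
  move=> s; rewrite /= in_itv/= => /andP[s0 st].
  have -> : d * (1 + q n s)
      = (e_ n)^-1 * (d * (e_ n + (xi (s + e_ n) - xi s) ^+ 2)).
    by rewrite /q; field; rewrite gt_eqF.
  have := expansion s.
  rewrite s0 (le_trans st tT) => /(_ isT).
  rewrite -(@ler_pM2l _ (e_ n)^-1) ?invr_gt0//; apply: le_trans.
  rewrite -[X in X * `|_|]gtr0_norm ?invr_gt0// -normrM le_eqVlt; apply/orP; left.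
  by apply/eqP; congr `|_|; rewrite /q; field; rewrite gt_eqF.
rewrite IZ// /I RintegralD//; try exact: lebesgue_continuous_integrable.
rewrite Rintegral_lebesgue_cst// /d mulrAC ler_pdivrMr ?ltr_pwDr// ?addr_ge0//.
rewrite ler_pM2l// -addrA lerD2l.
Unshelve. all: by end_near. Qed.

End ito.

(** * Continuity along windows *)

Local Notation glue := Defs.glue.
Local Notation shift := Defs.shift.

Section path_topology.
Context {R : realType} {T : {posnum R}}.
Implicit Types (M e : R) (gamma : bpast T).

Lemma eq_bpast gamma1 gamma2 : gamma1 =1 gamma2 -> gamma1 = gamma2.
Proof.
case: gamma1 gamma2 => [f1 o1 b1 c1] [f2 o2 b2 c2] /= /funext f12.
by move: o1 b1 c1; rewrite f12 => o1 b1 c1; congr BPast; exact: Prop_irrelevance.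
Qed.

Lemma eq_bpath (eta1 eta2 : bpath T) : eta1 =1 eta2 -> eta1 = eta2.
Proof.
case: eta1 eta2 => [f1 o1 b1 c1] [f2 o2 b2 c2] /= /funext f12.
by move: o1 b1 c1; rewrite f12 => o1 b1 c1; congr BPath; exact: Prop_irrelevance.
Qed.

Lemma glue0 gamma a : glue gamma a 0 = a.
Proof.
rewrite /= bpast_out ?add0r ?indicE ?mem_set ?mulr1//.
by rewrite /past /= in_itv/= ltxx andbF.
Qed.

Lemma glue_past gamma a x : past T x -> glue gamma a x = gamma x.
Proof.
rewrite /past /= in_itv/= => /andP[_ x0].
by rewrite indicE memNset ?mulr0 ?addr0// => /= xe; rewrite xe ltxx in x0.
Qed.

Lemma past_of_glue gamma a : past_of (glue gamma a) = gamma.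
Proof.
apply: eq_bpast => x /=; have [px|npx] := pselect (past T x).
  by rewrite /patch mem_set// -[LHS]/(glue gamma a x) glue_past.
by rewrite restrict_out// bpast_out.
Qed.

(** The subbase consists of seminorm balls with arbitrary centres, so a ball containing [eta] has to
    be recentred there by the triangle inequality. *)
Lemma bpathM_cvg (I : Type) (F : set_system I) (FF : Filter F) M
    (f : I -> bpathM T M) (eta : bpathM T M) :
  (forall K e, compact K -> K `<=` past T -> 0 < e -> \forall i \near F,
    (forall x, K x -> `|f i x - eta x| <= e) /\ `|f i 0 - eta 0| <= e) ->
  f @ F --> eta.
Proof.
move=> fF A /=; rewrite (@nbhsE (bpathM T M)).
move=> [_ [[B sB <-] [C BC Ct] sUBA]].
rewrite nbhs_filterE; apply: filterS sUBA _; apply: (@filterS _ _ _ C).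
  by move=> ? ?; exists C.
have /sB [D sD IDeC] := BC; rewrite -IDeC; apply: filter_bigI => E DE.
have /sD := DE; rewrite inE => - [K [eta0 [e [cK Kp e0 EE]]]].
have : E eta by move: Ct; rewrite -IDeC => /(_ _ DE).
(* A third of the slack: the compact part and the point [0] consume one third each, and the
   inequality stays strict. *)
rewrite EE /= => pe; pose r := (e - seminorm K (eta \- eta0)) / 3.
have r0 : 0 < r by rewrite divr_gt0// subr_gt0.
have := fF K r cK Kp r0; apply: filterS => i [fK f0] /=.
suff : seminorm K (f i \- eta0) <= seminorm K (eta \- eta0) + 2 * r.
  by move=> /le_lt_trans; apply; rewrite /r; lra.
rewrite /seminorm /= mulr2n mulrDl mul1r addrACA; apply: lerD; last first.
  rewrite (_ : _ - _ = (eta 0 - eta0 0) + (f i 0 - eta 0)); last by ring.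
  by rewrite (le_trans (ler_normD _ _))// lerD2l.
(* The supremum over an empty [K] is [0] by convention and is treated apart, since [ge_sup] needs an
   element. *)
have [->|/set0P[x0 Kx0]] := eqVneq K set0.
  by rewrite !image_set0 !sup0 add0r ltW.
apply: ge_sup; first by exists `|f i x0 - eta0 x0|; exists x0.
move=> _ [x Kx <-].
rewrite (_ : _ - _ = (eta x - eta0 x) + (f i x - eta x)); last by ring.
rewrite (le_trans (ler_normD _ _))// lerD ?fK//.
apply: ub_le_sup; last by exists x.
exists (M + M) => _ [y _ <-]; rewrite (le_trans (ler_normB _ _))// lerD//.
  exact: bpathM_le.
exact: bpathM_le.
Qed.

(** The inclusion of each [bpathM T M] is continuous for the inductive topology, so an eventual
    common bound reduces the claim to convergence for the seminorms. *)
Lemma bpath_continuous_cvg (u : bpath T -> R) (I : Type) (F : set_system I)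
    (FF : Filter F) M (f : I -> bpath T) (eta : bpath T) :
  continuous u -> 0 < M -> (forall x, `|eta x| <= M) ->
  (\forall i \near F, forall x, `|f i x| <= M) ->
  (forall K e, compact K -> K `<=` past T -> 0 < e -> \forall i \near F,
    (forall x, K x -> `|f i x - eta x| <= e) /\ `|f i 0 - eta 0| <= e) ->
  u (f i) @[i --> F] --> u eta.
Proof.
move=> cu M0 etaM fM ff.
pose etaM' := BPathM etaM.
(* Where the bound fails, [f'] takes the limit itself, which satisfies it. *)
pose f' i : bpathM T M := match pselect (forall x, `|f i x| <= M) with
  | left h => BPathM h | right _ => etaM' end.
have f'f : \forall i \near F, bpathM_val (f' i) = f i.
  by apply: filterS fM => i h; rewrite /f'; case: pselect.
have cf' : f' @ F --> etaM'.
  apply: bpathM_cvg => K e cK Kp e0; apply: filterS2 f'f (ff K e cK Kp e0).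
  by move=> i ->.
have cv : continuous (@bpathM_val R T M).
  by apply/continuousP => A; rewrite bpath_openE => /(_ _ M0).
have cuv : continuous (u \o @bpathM_val R T M).
  by move=> z; apply: continuous_comp; [exact: cv|exact: cu].
have : u (bpathM_val (f' i)) @[i --> F] --> u (bpathM_val etaM').
  exact: (cvg_comp _ _ cf' (cuv etaM')).
apply: cvg_trans; apply: near_eq_cvg; apply: filterS f'f.
by move=> i /= ->.
Qed.

End path_topology.

Section window_path.
Context {R : realType} {T : {posnum R}} {d : measure_display}
  {Om : measurableType d} (X : cprocess Om T) (w : Om).
Implicit Types (s t a x e : R).

Let xi t := extend X t w.

Definition past_window s := past_of (bpath_of_cpath (window X s w)).

Lemma extend_le0 t : t <= 0 -> xi t = X 0 w.
Proof.
move=> t0; rewrite /xi /extend; congr (X _ w); apply/max_idPl.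
by rewrite ge_min t0 orbT.
Qed.

Lemma extend_bounded : exists2 M, 0 < M & forall t, `|xi t| <= M.
Proof.
have [|c _ hc] := @EVT_max _ (fun t => `|xi t|) 0 T%:num (ge0 T).
  apply: continuous_subspaceT => t; apply: cvg_norm.
  exact: (extend_continuous (X := X) (w := w)).
exists (`|xi c| + 1) => [|t]; first by rewrite ltr_pwDr.
have [c0 cT] : 0 <= Num.max 0 (Num.min T%:num t) /\
    Num.max 0 (Num.min T%:num t) <= T%:num.
  by rewrite le_max lexx/= ge_max ge0/= ge_min lexx.
rewrite ler_wpDr//; have -> : xi t = xi (Num.max 0 (Num.min T%:num t)).
  by rewrite /xi /extend (min_idPr cT) (max_idPr c0).
by apply: hc; rewrite in_itv/= c0.
Qed.

Lemma past_windowE s x : past T x -> past_window s x = xi (s + x).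
Proof.
move=> px; rewrite /past_window /= /patch mem_set// mem_set//.
exact: past_dom.
Qed.

Lemma bpath_of_window s :
  bpath_of_cpath (window X s w) = glue (past_window s) (xi s).
Proof.
apply: eq_bpath => x; have [px|npx] := pselect (past T x).
  by rewrite glue_past// past_windowE//= /patch mem_set//; exact: past_dom.
have [->|x0] := eqVneq x 0.
  rewrite glue0 /= /patch mem_set ?addr0//.
  by rewrite /dom/= in_itv/= lexx oppr_le0 ge0.
have ndx : ~ dom T x.
  rewrite /dom/= in_itv/= => /andP[Tx x0']; apply: npx.
  by rewrite /past/= in_itv/= Tx lt_neqAle x0 x0'.
by rewrite !bpath_out.
Qed.

(** Two conventions agree: a shift repeats the value at [-T], which for [s <= T] is the path at time
    [s - T <= 0], where the extension is frozen at [X 0]. *)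
Lemma shift_past_window s e : 0 <= e -> e <= s -> s <= T%:num ->
  shift (past_window s) e = past_window (s - e).
Proof.
move=> e0 es sT; apply: eq_bpast => x.
have [px|npx] := pselect (past T x); last by rewrite !bpast_out.
have {1}-> : shift (past_window s) e x
    = past_window s (Num.max (- T%:num) (x - Num.max 0 e)).
  by rewrite /= {1}/patch mem_set.
have /andP[Tx x0] : - T%:num <= x < 0 by move: px; rewrite /past/= in_itv.
rewrite (max_idPr e0) past_windowE; last first.
  rewrite /past/= in_itv/= le_max lexx/= gt_max oppr_lt0 gt0/=.
  by rewrite subr_lt0 (lt_le_trans x0).
rewrite past_windowE//; have [h|h] := leP (- T%:num) (x - e).
  by congr xi; ring.
by rewrite !extend_le0//; lra.
Qed.

(** Uniform continuity of the path makes pasts at nearby times uniformly close, and a common bound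
    keeps them in one ball. As [a] is independent of the path, the glued function usually jumps at
    [0]. *)
Lemma continuous_glue_window (v : bpath T -> R) : continuous v ->
  continuous (fun p : R * R => v (glue (past_window p.1) p.2)).
Proof.
move=> cv [s a]; have [M M0 xiM] := extend_bounded.
have gM s' a' : `|a'| <= `|a| + 1 ->
    forall x, `|glue (past_window s') a' x| <= M + (`|a| + 1).
  move=> aa x; have [px|npx] := pselect (past T x).
    by rewrite glue_past// past_windowE// ler_wpDr ?addr_ge0.
  have [->|x0] := eqVneq x 0; first by rewrite glue0 ler_wpDl// ltW.
  have ndx : ~ dom T x.
    rewrite /dom/= in_itv/= => /andP[Tx x0']; apply: npx.
    by rewrite /past/= in_itv/= Tx lt_neqAle x0 x0'.
  by rewrite bpath_out// normr0 addr_ge0 ?addr_ge0// ltW.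
apply: (@bpath_continuous_cvg _ _ v _ _ _ (M + (`|a| + 1))
  (fun p => glue (past_window p.1) p.2) (glue (past_window s) a)) => //.
- by rewrite ltr_pwDl// addr_ge0.
- by apply: gM; rewrite ler_wpDr.
- have : \forall p \near (s, a), `|a - p.2| < 1.
    exists (setT, ball a 1) => /=; first by split; [exact: filterT|exact: nbhsx_ballx].
    by move=> [s' a'] [_]; rewrite /= -ball_normE.
  apply: filterS => -[s' a'] /= aa'; apply: gM => /=.
  rewrite -(subrK a a') (le_trans (ler_normD _ _))// addrC lerD2l distrC ltW//.
move=> K e cK Kp e0.
have cxi : continuous xi by exact: extend_continuous.
near (0:R)^'+ => r.
have r0 : 0 < r by near: r; exact: nbhs_right_gt.
have hr : forall x y, `[s - T%:num, s]%classic x -> ball x r y -> `|xi x - xi y| < e.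
  by near: r; exact: (compact_uniform_continuity (@segment_compact R _ _) cxi).
have : \forall p \near (s, a), ball s r p.1 /\ ball a e p.2.
  exists (ball s r, ball a e) => /=; first by split; exact: nbhsx_ballx.
  by move=> [s' a'].
apply: filterS => p [ss' aa']; split; last first.
  by rewrite !glue0 distrC ltW//; move: aa'; rewrite -ball_normE.
move=> x /Kp px; rewrite !glue_past// !past_windowE//.
rewrite distrC ltW//; apply: hr.
  by move: px; rewrite /past /= !in_itv/= => /andP[? ?]; apply/andP; split; lra.
by move: ss'; rewrite -!ball_normE /=; congr (`|_| < _); ring.
Unshelve. all: by end_near. Qed.

End window_path.

(** * The functional as a function of time and present *)

Section functional_along_window.
Context {R : realType} {T : {posnum R}} {d : measure_display}
  {Om : measurableType d} (X : cprocess Om T) (w : Om).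
Implicit Types (s t a x e : R) (gamma : bpast T).
Variable u : bpath T -> R.
Hypothesis uC12 : past_present_C12 u.

Lemma DV_glue gamma a : DV u (glue gamma a) = dtilde u gamma a.
Proof. by rewrite /DV past_of_glue glue0. Qed.

Lemma DVV_glue gamma a : DVV u (glue gamma a) = derive1 (dtilde u gamma) a.
Proof. by rewrite /DVV past_of_glue glue0. Qed.

Lemma DH_glue gamma a : DH u (glue gamma a) = DHtilde u gamma a.
Proof. by rewrite /DH past_of_glue glue0. Qed.

Lemma is_derive_tilde gamma a : is_derive a 1 (tilde u gamma) (dtilde u gamma a).
Proof.
have := @C12_has_DV _ _ _ uC12 (glue gamma a); rewrite past_of_glue glue0 => h.
exact: (DeriveDef h (esym (derive1E _ _))).
Qed.

Lemma is_derive_dtilde gamma a :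
  is_derive a 1 (dtilde u gamma) (derive1 (dtilde u gamma) a).
Proof.
have := @C12_has_DVV _ _ _ uC12 (glue gamma a); rewrite past_of_glue glue0 => h.
exact: (DeriveDef h (esym (derive1E _ _))).
Qed.

Lemma horizontal_quotient_cvg gamma a :
  horizontal_quotient u gamma a e @[e --> 0^'+] --> DHtilde u gamma a.
Proof.
by have := @C12_has_DH _ _ _ uC12 (glue gamma a); rewrite past_of_glue glue0.
Qed.

(** Beyond [T] the pasts are no longer shifts of the past at [T], and continuity along those shifts
    says nothing there. Clipping time gives functions continuous on the whole plane. *)
Let clip s : R := Num.max 0 (Num.min T%:num s).

Let clip_itv s : 0 <= clip s <= T%:num.
Proof. by rewrite /clip le_max lexx/= ge_max ge0/= ge_min lexx. Qed.

Let clip_id s : 0 <= s <= T%:num -> clip s = s.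
Proof. by move=> /andP[s0 sT]; rewrite /clip (min_idPr sT) (max_idPr s0). Qed.

Let clip_continuous : continuous clip.
Proof.
move=> s; apply: (@continuous_comp _ _ _ (Num.min T%:num) (Num.max 0)).
  exact: continuous_minl.
exact: continuous_maxl.
Qed.

Definition window_DH s a := DHtilde u (past_window X w (clip s)) a.
Definition window_DV s a := dtilde u (past_window X w (clip s)) a.
Definition window_DVV s a := derive1 (dtilde u (past_window X w (clip s))) a.

(* Past [T] the value is extended affinely in time, so that the increments
   over [s, s + e] need no special treatment when [s + e > T]. *)
Definition window_value s a :=
  tilde u (past_window X w (clip s)) a
  + Num.max 0 (s - T%:num) * window_DH T%:num a.

Let continuous_clip_pair (v : R * R -> R) : continuous v ->
  continuous (fun p : R * R => v (clip p.1, p.2)).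
Proof.
move=> cv p; apply: (@continuous_comp _ _ _ (fun p => (clip p.1, p.2)) v);
  last exact: cv.
move: p; apply: continuous_pair => p; last exact: cvg_snd.
apply: (@continuous_comp _ _ _ fst clip); last exact: clip_continuous.
exact: cvg_fst.
Qed.

Lemma window_DV_continuous : continuous (fun p : R * R => window_DV p.1 p.2).
Proof.
have := continuous_clip_pair (@continuous_glue_window _ _ _ _ X w _
  (@C12_DV_continuous _ _ _ uC12)).
by under eq_fun do rewrite DV_glue.
Qed.

Lemma window_DVV_continuous : continuous (fun p : R * R => window_DVV p.1 p.2).
Proof.
have := continuous_clip_pair (@continuous_glue_window _ _ _ _ X w _
  (@C12_DVV_continuous _ _ _ uC12)).
by under eq_fun do rewrite DVV_glue.
Qed.

Lemma window_DH_continuous : continuous (fun p : R * R => window_DH p.1 p.2).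
Proof.
have E (p : R * R) : window_DH p.1 p.2
    = DHtilde u (shift (past_window X w T%:num) (T%:num - clip p.1)) p.2.
  have /andP[c0 cT] := clip_itv p.1.
  rewrite shift_past_window ?subr_ge0// ?lerBlDr ?lerDl// /window_DH.
  by rewrite (_ : T%:num - _ = clip p.1)//; ring.
have := @C12_DH_continuous _ _ _ uC12 (past_window X w T%:num).
move=> /subspace_continuousP cD p.
pose k (p : R * R) := (T%:num - clip p.1, p.2).
have ck : continuous k.
  apply: continuous_pair => q; last exact: cvg_snd.
  apply: cvgB; first exact: cvg_cst.
  apply: (@continuous_comp _ _ _ fst clip); last exact: clip_continuous.
  exact: cvg_fst.
(* The shifts are nonnegative, so continuity within the half-plane pulls back to continuity on the
   whole plane. *)
have k0 q : 0 <= (k q).1 by have /andP[_] := clip_itv q.1; rewrite subr_ge0.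
under eq_fun do rewrite E.
rewrite /continuous_at.
move=> S /= /(cD (k p) (k0 p)); rewrite /within /= !nbhs_simpl /= => h.
by have := ck p _ h; rewrite !nbhs_simpl /=; apply: filterS => q /(_ (k0 q)).
Qed.

Lemma window_value_continuous :
  continuous (fun p : R * R => window_value p.1 p.2).
Proof.
move=> p; apply: cvgD.
  exact: (continuous_clip_pair (@continuous_glue_window _ _ _ _ X w _
    (@C12_continuous _ _ _ uC12))).
apply: cvgM.
  apply: (@continuous_comp _ _ _ (fun p : R * R => p.1 - T%:num) (Num.max 0)).
    by apply: cvgB; [exact: cvg_fst|exact: cvg_cst].
  exact: continuous_maxl.
apply: (@continuous_comp _ _ _ (fun p : R * R => (T%:num, p.2))
  (fun p : R * R => window_DH p.1 p.2)); last exact: window_DH_continuous.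
by move: p; apply: continuous_pair => p; [exact: cvg_cst|exact: cvg_snd].
Qed.

(** Up to [T] a backward step is a shift, and beyond [T] the value is affine. Small backward steps
    never straddle [T], so left derivatives require no matching of slopes at the junction. *)
Lemma window_value_primitive a :
  primitive_wrt id (window_DH ^~ a) (window_value ^~ a).
Proof.
move=> s t c r s0 st Hc.
apply: (@left_derivative_dist _ (window_value ^~ a) (window_DH ^~ a)) => //.
- apply: continuous_subspaceT => x.
  apply: (@continuous_comp _ _ _ (fun x => (x, a))
    (fun p : R * R => window_value p.1 p.2)); last exact: window_value_continuous.
  by move: x; apply: continuous_pair => x; [exact: cvg_id|exact: cvg_cst].
- move=> x /andP[sx xt]; have x0 : 0 < x by exact: le_lt_trans sx.
  have [xT|Tx] := leP x T%:num.
    have cx : clip x = x by rewrite clip_id// ltW.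
    have := @horizontal_quotient_cvg (past_window X w x) a.
    rewrite /window_DH cx; apply: cvg_trans; apply: near_eq_cvg; near=> e.
    have e0 : 0 < e by near: e; exact: nbhs_right_gt.
    have ex : e < x by near: e; exact: nbhs_right_lt.
    rewrite /horizontal_quotient shift_past_window//; try exact: ltW.
    rewrite /window_value cx clip_id; last by apply/andP; split; lra.
    by rewrite !(max_idPl _) ?mul0r ?addr0//; lra.
  have cT y : T%:num <= y -> clip y = T%:num.
    by move=> Ty; rewrite /clip (min_idPl Ty) (max_idPr (ge0 T)).
  have -> : window_DH x a = window_DH T%:num a.
    by rewrite /window_DH !cT ?lexx// ltW.
  apply: cvg_near_cst; near=> e.
  have e0 : 0 < e by near: e; exact: nbhs_right_gt.
  have ex : e < x - T%:num by near: e; apply: nbhs_right_lt; rewrite subr_gt0.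
  rewrite /window_value !cT; [|lra|lra].
  rewrite !(max_idPr _); [|lra|lra].
  by field; rewrite gt_eqF.
- by move=> x /andP[sx xt]; apply: Hc; rewrite xt ltW.
Unshelve. all: by end_near. Qed.

End functional_along_window.

(** * Measurability of functionals of the window *)

Lemma measurable_fun_countable_comp d (Om : measurableType d) (R : realType)
    (I : countType) (k : Om -> I) (V : I -> R) :
  (forall i, measurable [set w | k w = i]) ->
  measurable_fun setT (fun w => V (k w)).
Proof.
move=> mk _ B mB; rewrite setTI.
have -> : (fun w => V (k w)) @^-1` B
    = \bigcup_i ([set w | k w = i] `&` [set _ | B (V i)]).
  apply/seteqP; split => [w /= Bw|w [i _ [/= <-]]//].
  by exists (k w).
apply: countable_bigcupT_measurable => [|i]; first exact: countableP.
have [VB|nVB] := pselect (B (V i)).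
  by rewrite (_ : [set _ : Om | B (V i)] = setT) ?setIT//; apply/seteqP; split.
by rewrite (_ : [set _ : Om | B (V i)] = set0) ?setI0//; apply/seteqP; split.
Qed.

Section interpolation.
Context {R : realType} (T : {posnum R}).
Implicit Types (x r : R).

(* Dividing by the sum of the hat functions, as in Shepard interpolation, avoids
   having to know that they form a partition of unity. *)
Definition hat (N i : nat) x : R :=
  Num.max 0 (1 - `|N%:R * x / T%:num + i%:R|).

Definition hat_sum (N : nat) x : R := \sum_(i < N.+1) hat N i x.

Lemma hat_ge0 N i x : 0 <= hat N i x.
Proof. by rewrite le_max lexx. Qed.

Lemma hat_sum_gt0 N x : (0 < N)%N -> dom T x -> 0 < hat_sum N x.
Proof.
move=> N0; rewrite /dom/= in_itv/= => /andP[Tx x0].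
have N0' : 0 < N%:R :> R by rewrite ltr0n.
(* [y] measures [x] in mesh units leftwards from [0]; the node indexed by its integer part is less
   than one mesh away. *)
pose y := - (N%:R * x / T%:num).
have y0 : 0 <= y.
  by rewrite /y -mulNr -mulrN !mulr_ge0// ?invr_ge0// oppr_ge0.
have yN : y <= N%:R.
  by rewrite /y -mulNr -mulrN ler_pdivrMr// ler_pM2l//; lra.
have /andP[iy yi] := truncn_itv y0.
have iN : (Num.truncn y < N.+1)%N.
  by rewrite ltnS -(ler_nat R) (le_trans iy).
rewrite /hat_sum (bigD1 (Ordinal iN))//= ltr_pwDl//; last first.
  by apply: sumr_ge0 => i _; exact: hat_ge0.
rewrite /hat lt_max ltxx/= subr_gt0 -[X in `|X + _|]opprK -/y addrC distrC.
by rewrite ger0_norm ?subr_ge0//; move: yi; rewrite -natr1; lra.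
Qed.

Lemma hat_continuous N i : continuous (hat N i).
Proof.
move=> x; apply: (@continuous_comp _ _ _
  (fun x => 1 - `|N%:R * x / T%:num + i%:R|) (Num.max 0)).
  apply: cvgB; first exact: cvg_cst.
  apply: cvg_norm; apply: cvgD; last exact: cvg_cst.
  apply: cvgM; last exact: cvg_cst.
  by apply: cvgM; [exact: cvg_cst|exact: cvg_id].
exact: continuous_maxl.
Qed.

Program Definition interpolate (N : nat) (c : nat -> R) : cpath T :=
  @CPath _ _ ((fun x => (\sum_(i < N.+2) c i * hat N.+1 i x) / hat_sum N.+1 x)
    \_ (dom T)) _ _.
Next Obligation. by move=> N c x Dx; rewrite restrict_out. Qed.
Next Obligation.
move=> N c; apply: within_continuous_restrict => //.
apply: continuous_in_subspaceT => x; rewrite inE => Dx.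
apply: cvgM.
  apply: cvg_big => [|i _]; first exact: add_continuous.
  by apply: cvgM; [exact: cvg_cst|exact: hat_continuous].
apply: cvgV; first by rewrite gt_eqF// hat_sum_gt0.
apply: cvg_big => [|i _]; first exact: add_continuous.
exact: hat_continuous.
Qed.

(** An interpolated value is a convex combination of those [c i] whose node is less than one mesh
    away from [x]. *)
Lemma interpolate_dist N (c : nat -> R) x y r : dom T x ->
  (forall i, (i < N.+2)%N -> `|N.+1%:R * x / T%:num + i%:R| < 1 ->
    `|c i - y| <= r) ->
  `|interpolate N c x - y| <= r.
Proof.
move=> Dx cr; have W0 := hat_sum_gt0 (ltn0Sn N) Dx.
rewrite /= /patch mem_set//.
have -> : (\sum_(i < N.+2) c i * hat N.+1 i x) / hat_sum N.+1 x - y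
    = (\sum_(i < N.+2) (c i - y) * hat N.+1 i x) / hat_sum N.+1 x.
  under [in RHS]eq_bigr do rewrite mulrBl.
  by rewrite sumrB -mulr_sumr -/(hat_sum N.+1 x) mulrBl mulfK// gt_eqF.
rewrite normrM normfV (gtr0_norm W0) ler_pdivrMr//.
rewrite (le_trans (ler_norm_sum _ _ _))// /hat_sum mulr_sumr.
apply: ler_sum => i _; rewrite normrM (ger0_norm (hat_ge0 _ _ _)).
have [h1|h1] := ltP `|N.+1%:R * x / T%:num + i%:R| 1.
  by rewrite ler_wpM2r ?hat_ge0// cr.
have -> : hat N.+1 i x = 0 by apply/max_idPl; rewrite subr_le0.
by rewrite !mulr0.
Qed.

End interpolation.

Section window_measurability.
Context {R : realType} {T : {posnum R}} {d : measure_display}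
  {Om : measurableType d} (X : cprocess Om T).
Implicit Types (s t : R) (N : nat) (w : Om).

Lemma extend_measurable t : measurable_fun setT (extend X t).
Proof.
apply: cprocess_measurable.
by rewrite in_itv/= le_max lexx/= ge_max ge0/= ge_min lexx.
Qed.

(* The values are rounded so that the sampled path takes countably many values:
   any function of it is then measurable. *)
Definition sample s N w : {ffun 'I_N.+2 -> int} :=
  [ffun i : 'I_N.+2 =>
    Num.floor (N.+1%:R * extend X (s - T%:num * i%:R / N.+1%:R) w)].

Definition sample_path s N (k : {ffun 'I_N.+2 -> int}) : cpath T :=
  interpolate T N (fun i => (k (inord i))%:~R / N.+1%:R).

Lemma sample_measurable s N k : measurable [set w | sample s N w = k].
Proof.
have -> : [set w | sample s N w = k] = \bigcap_(i in [set: 'I_N.+2])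
    [set w | sample s N w i = k i].
  apply/seteqP; split => [w /= <- i //|w h /=]; apply/ffunP => i; exact: h.
apply: fin_bigcap_measurable => [|i _]; first exact: finite_finset.
pose f w := N.+1%:R * extend X (s - T%:num * i%:R / N.+1%:R) w.
have mf : measurable_fun setT f.
  by apply: measurable_funM => //; exact: extend_measurable.
have -> : [set w | sample s N w i = k i]
    = setT `&` f @^-1` `[(k i)%:~R, (k i + 1)%:~R[.
  rewrite setTI; apply/seteqP; split => w /=; rewrite ffunE in_itv/= -floor_eq.
    by move=> /eqP.
  by move=> /eqP.
exact: mf.
Qed.

(** Rounding costs at most [1 / (N + 1)], and passing to a nearby node costs the oscillation of the
    path over one mesh [T / (N + 1)]. *)
Lemma sample_path_cvg s w (e : R) : 0 < e ->
  \forall N \near \oo, forall x, dom T x ->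
    `|sample_path s (sample s N w) x - extend X (s + x) w| <= e.
Proof.
move=> e0; have e2 : 0 < e / 2 by rewrite divr_gt0.
near (0:R)^'+ => r.
have r0 : 0 < r by near: r; exact: nbhs_right_gt.
have hr : forall x y, `[s - T%:num, s]%classic x -> ball x r y ->
    `|extend X x w - extend X y w| < e / 2.
  near: r; apply: (compact_uniform_continuity (@segment_compact R _ _)) => //.
  exact: extend_continuous.
near=> N => x Dx.
have N0 : 0 < N.+1%:R :> R by rewrite ltr0n.
have Tr : T%:num / N.+1%:R < r.
  rewrite ltr_pdivrMr// mulrC -ltr_pdivrMr//.
  apply: (@lt_trans _ _ N%:R); last by rewrite ltr_nat.
  by near: N; exact: nbhs_infty_gtr.
have eN : N.+1%:R^-1 <= e / 2.
  rewrite -[leRHS]invrK lef_pV2 ?posrE ?invr_gt0// ltW//.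
  apply: (@lt_trans _ _ N%:R); last by rewrite ltr_nat.
  by near: N; exact: nbhs_infty_gtr.
apply: interpolate_dist => // i iN hi; rewrite ffunE inordK//.
set z := s - _; have zx : `|s + x - z| < r.
  apply: le_lt_trans Tr; rewrite /z.
  have -> : s + x - (s - T%:num * i%:R / N.+1%:R)
    = (T%:num / N.+1%:R) * (N.+1%:R * x / T%:num + i%:R).
    by field; rewrite !gt_eqF.
  rewrite normrM gtr0_norm ?divr_gt0// ler_piMr ?divr_ge0 ?ltW//.
have h1 : `|(Num.floor (N.+1%:R * extend X z w))%:~R / N.+1%:R - extend X z w|
    <= e / 2.
  apply: le_trans eN.
  have -> : (Num.floor (N.+1%:R * extend X z w))%:~R / N.+1%:R - extend X z w
      = N.+1%:R^-1
        * ((Num.floor (N.+1%:R * extend X z w))%:~R - N.+1%:R * extend X z w).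
    by field; rewrite gt_eqF.
  rewrite normrM gtr0_norm ?invr_gt0// ler_piMr ?invr_ge0//.
  have /andP[] := floor_itv (N.+1%:R * extend X z w).
  by rewrite intrD ler_norml; lra.
have h2 : `|extend X (s + x) w - extend X z w| < e / 2.
  apply: hr; last by rewrite -ball_normE.
  by move: Dx; rewrite /dom/= !in_itv/= => /andP[? ?]; apply/andP; split; lra.
rewrite (_ : _ - _ = ((Num.floor (N.+1%:R * extend X z w))%:~R / N.+1%:R
  - extend X z w) - (extend X (s + x) w - extend X z w)); last by ring.
by rewrite (le_trans (ler_normB _ _))// (splitr e) lerD// ltW.
Unshelve. all: by end_near. Qed.

(** Instead of treating the window as a random element of a path space, the functional is obtained
    as a pointwise limit along rounded samples, which converge uniformly and stay in one ball. *)
Lemma window_functional_measurable (v : bpath T -> R) s : continuous v ->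
  measurable_fun setT (fun w => v (bpath_of_cpath (window X s w))).
Proof.
move=> cv.
apply: (@measurable_fun_cvg _ _ _ _
  (fun N w => v (bpath_of_cpath (sample_path s (sample s N w))))).
  move=> N; apply: (measurable_fun_countable_comp
    (fun k => v (bpath_of_cpath (sample_path s k)))) => k.
  exact: sample_measurable.
move=> w _; have [M M0 XM] := extend_bounded X w.
have windowE x : dom T x -> window X s w x = extend X (s + x) w.
  by move=> Dx; rewrite /= /patch mem_set.
have D0 : dom T 0 by rewrite /dom/= in_itv/= lexx oppr_le0 ge0.
apply: (@bpath_continuous_cvg _ _ v _ _ _ (M + 1)) => //.
- by rewrite ltr_pwDr// ltW.
- move=> x; have [Dx|nDx] := pselect (dom T x).
    by have := XM (s + x); rewrite -windowE// => h; exact: ler_wpDr ler01 h.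
  by rewrite bpath_out// normr0 addr_ge0// ltW.
- have := sample_path_cvg s w (@ltr01 R); apply: filterS => N h x.
  have [Dx|nDx] := pselect (dom T x); last first.
    by rewrite bpath_out// normr0 addr_ge0// ltW.
  have := h x Dx; rewrite /= => hx.
  rewrite -[X in `|X|](subrK (extend X (s + x) w)) addrC.
  by rewrite (le_trans (ler_normD _ _))// lerD.
move=> K e cK Kp e0; have := sample_path_cvg s w e0; apply: filterS => N h.
split=> [x /Kp /past_dom Dx|].
  by have := h x Dx; rewrite -windowE.
by have := h 0 D0; rewrite -windowE.
Qed.

End window_measurability.

Section integral_measurability.
Context {R : realType} {d : measure_display} {Om : measurableType d}.

(** Pathwise continuity makes the integral a pointwise limit of Riemann sums, which are finite sums
    of random variables. *)
Lemma Rintegral_continuous_measurable (g : R -> Om -> R) (t : R) : 0 <= t ->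
  (forall s, measurable_fun setT (g s)) -> (forall w, continuous (g ^~ w)) ->
  measurable_fun setT (fun w => \int[lebesgue_measure]_(s in `[0, t]) g s w).
Proof.
move=> t0 mg cg.
apply: (@measurable_fun_cvg _ _ _ _
  (fun N w => riemann_sum id (g ^~ w) t N)).
  move=> N; apply: measurable_sum => i.
  by apply: measurable_funM; [exact: mg|exact: measurable_cst].
move=> w _; apply/cvgrPdist_le => e e0.
have e1 : 0 < e / (t + 1) by rewrite divr_gt0// ltr_pwDr.
have := primitive_riemann_sum (cg w) t0 e1; apply: filterS => N h.
have := h _ _ (primitive_lebesgue (cg w)).
rewrite Rintegral_itv00; last exact: lebesgue_set0.
rewrite subr0 => /le_trans; apply; rewrite /= subr0 mulrAC ler_pdivrMr ?ltr_pwDr//.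
by rewrite ler_pM2l// lerDl.
Qed.

End integral_measurability.

(** * Convergence in probability *)

Section convergence_in_probability.
Context d (Om : measurableType d) (R : realType) (P : probability Om R).
Implicit Types (e r : R) (w : Om).

(* [S] is an arbitrary set of steps accumulating at [0+]: the subsequence can
   therefore be chosen inside a set where convergence is supposed to fail. *)
Lemma cvg_in_probability_subsequence (F : nat -> R -> Om -> R)
    (Z : nat -> Om -> R) (S : set R) :
  (forall j, cvg_in_probability P (F j) (Z j)) ->
  (forall A : set R, (\forall e \near 0^'+, A e) -> exists2 e, S e & A e) ->
  exists2 e_ : nat -> R,
    (forall n, S (e_ n) /\ 0 < e_ n) /\ e_ n @[n --> \oo] --> 0^'+ &
    exists N : set Om, [/\ measurable N, P N = 0%E &
      forall w, ~ N w -> forall j, F j (e_ n) w @[n --> \oo] --> Z j w].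
Proof.
(* One sequence serves both as threshold and as bound on the probability: it tends to [0] and is
   summable, as Borel-Cantelli requires. *)
move=> FZ S0; pose tol (k : nat) : R := 1 / (2 ^ k.+1)%:R.
have tol0 k : 0 < tol k by rewrite divr_gt0// ltr0n expn_gt0.
pose bad j k e := [set w | tol k < `|F j e w - Z j w|].
have mbad j k e : 0 < e -> measurable (bad j k e).
  move=> e0; have [/(_ _ e0) mF mZ _] := FZ j.
  have mG : measurable_fun setT (fun w => `|F j e w - Z j w|).
    by apply: measurableT_comp => //; exact: measurable_funB.
  have := mG measurableT _ (measurable_itv `]tol k, +oo[).
  by rewrite setTI; congr measurable; apply/seteqP; split => w /=;
    rewrite in_itv/= andbT.
(* Diagonal choice: the [k]-th step only has to suit the finitely many [j <= k]. *)
have [e_ he] : {e_ : nat -> R & forall k, [/\ S (e_ k), 0 < e_ k < k.+1%:R^-1 &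
    forall j, (j <= k)%N -> (P (bad j k (e_ k)) < (tol k)%:E)%E]}.
  apply: (@choice _ _ (fun k e => [/\ S e, 0 < e < k.+1%:R^-1 &
    forall j, (j <= k)%N -> (P (bad j k e) < (tol k)%:E)%E])) => k.
  have [|e Se [e0 ek he]] := S0 [set e | [/\ 0 < e, e < k.+1%:R^-1 &
      forall j : 'I_k.+1, (P (bad j k e) < (tol k)%:E)%E]].
    near=> e; split.
    - by near: e; exact: nbhs_right_gt.
    - by near: e; exact: nbhs_right_lt.
    near: e; apply: filter_forall => j.
    have [_ _ /(_ _ (tol0 k)) cF] := FZ j.
    have /fine_cvgP[_ /cvgr_lt h] := cF.
    near=> e.
    have e0 : 0 < e by near: e; exact: nbhs_right_gt.
    rewrite -[X in (X < _)%E]fineK; last by apply: fin_num_measure; exact: mbad.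
    by rewrite lte_fin; near: e; exact: h.
  exists e; split => //; first by rewrite e0.
  by move=> j jk; exact: (he (Ordinal (jk : (j < k.+1)%N))).
exists e_.
  split; first by move=> n; have [? /andP[]] := he n.
  move=> A [r /= r0 rA]; suff : \forall n \near \oo, A (e_ n) by [].
  near=> n.
  have [_ /andP[en0 enn] _] := he n; apply: rA => //=.
  rewrite sub0r normrN gtr0_norm// (lt_trans enn)//.
  rewrite -[ltRHS]invrK ltf_pV2 ?posrE ?invr_gt0//.
  apply: (@lt_trans _ _ n%:R); last by rewrite ltr_nat.
  by near: n; exact: nbhs_infty_gtr.
(* For a given [j] only the steps from index [j] on are controlled, hence the shift by [j]. *)
pose B j n := bad j (n + j)%N (e_ (n + j)%N).
have mB j n : measurable (B j n).
  by apply: mbad; have [_ /andP[]] := he (n + j)%N.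
have mL j : measurable (lim_sup_set (B j)).
  by apply: bigcapT_measurable => n; apply: bigcup_measurable => k _.
have mN : measurable (\bigcup_j lim_sup_set (B j)) by exact: bigcupT_measurable.
exists (\bigcup_j lim_sup_set (B j)); split => //.
  apply/(negligibleP P mN); apply: negligible_bigcup => j.
  apply/(negligibleP P (mL j)).
  apply: lim_sup_set_cvg0 => //.
  apply: (@le_lt_trans _ _ 1%:E); last by rewrite ltry.
  apply: le_trans (epsilon_trick0 xpredT (@ler01 R)).
  apply: lee_nneseries => // n _.
  have [_ _ /(_ j (leq_addl _ _)) /ltW /le_trans] := he (n + j)%N; apply.
  rewrite lee_fin /tol ler_pM2l// lef_pV2 ?posrE ?ltr0n ?expn_gt0//.
  by rewrite ler_nat leq_exp2l// ltnS leq_addr.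
move=> w wN j; apply/cvgrPdist_le => r r0.
have [n wn] : exists n, forall k, (n <= k)%N -> ~ B j k w.
  apply: contrapT => hn; apply: wN; exists j => // n _.
  apply: contrapT => hk; apply: hn; exists n => k nk Bk; apply: hk.
  by exists k.
near=> m.
have nm : (n + j <= m)%N by near: m; exact: nbhs_infty_ge.
have jm : (j <= m)%N by exact: leq_trans (leq_addl _ _) nm.
have : ~ B j (m - j)%N w by apply: wn; rewrite leq_subRL// addnC.
rewrite /B /bad subnK// => /negP; rewrite -leNgt distrC => /le_trans; apply.
rewrite /tol div1r -[leRHS]invrK lef_pV2 ?posrE ?invr_gt0 ?ltr0n ?expn_gt0//.
apply: (@le_trans _ _ m%:R); last first.
  by rewrite ler_nat ltnW// (ltn_trans _ (ltn_expl _ _)).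
by near: m; exact: nbhs_infty_ger.
Unshelve. all: by end_near. Qed.

(** If the probability of deviation did not tend to [0], the steps where it exceeds some [del] would
    form an admissible [S]. Along an almost surely convergent sequence in [S] the upper limit of the
    bad events is null, so their probabilities tend to [0], a contradiction. *)
Lemma cvg_in_probability_ae (F : R -> Om -> R) (Z : Om -> R) :
  (forall e, 0 < e -> measurable_fun setT (F e)) -> measurable_fun setT Z ->
  (forall S : set R,
    (forall A : set R, (\forall e \near 0^'+, A e) -> exists2 e, S e & A e) ->
    exists2 e_ : nat -> R, forall n, S (e_ n) /\ 0 < e_ n &
    exists N : set Om, [/\ measurable N, P N = 0%E &
      forall w, ~ N w -> F (e_ n) w @[n --> \oo] --> Z w]) ->
  cvg_in_probability P F Z.
Proof.
move=> mF mZ sub; split => // r r0.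
pose bad e := [set w | r < `|F e w - Z w|].
have mbad e : 0 < e -> measurable (bad e).
  move=> e0.
  have mG : measurable_fun setT (fun w => `|F e w - Z w|).
    by apply: measurableT_comp => //; apply: measurable_funB => //; exact: mF.
  have := mG measurableT _ (measurable_itv `]r, +oo[).
  by rewrite setTI; congr measurable; apply/seteqP; split => w /=;
    rewrite in_itv/= andbT.
apply/fine_cvgP; split.
  by near=> e; apply: fin_num_measure; apply: mbad; near: e; exact: nbhs_right_gt.
apply/cvgrPdist_le => del del0; apply: contrapT => nn.
have [A hA|e_ he [N [mN N0 hN]]] := sub [set e | ~ `|0 - fine (P (bad e))| <= del].
  apply: contrapT => hS; apply: nn; apply: filterS hA => e Ae.
  by apply: contrapT => hd; apply: hS; exists e.
have mB n : measurable (bad (e_ n)) by apply: mbad; have [] := he n.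
have L0 : P (lim_sup_set (fun n => bad (e_ n))) = 0%E.
  apply/eqP; rewrite -measure_le0 -N0; apply: le_measure; rewrite ?inE//.
    by apply: bigcapT_measurable => n; apply: bigcup_measurable => k _.
  move=> w Lw; apply: contrapT => /hN /cvgrPdist_le/(_ r r0)[n _ hn].
  have [m /= nm] := Lw n I; rewrite /bad /= ltNge distrC => /negP; apply.
  exact: hn.
have : P (\bigcup_(k >= n) bad (e_ k)) @[n --> \oo] --> 0%E.
  rewrite -L0; apply: lim_sup_set_cvg => //.
  by rewrite (le_lt_trans (probability_le1 _ _)) ?ltry//; exact: bigcup_measurable.
move=> /fine_cvgP[_ /cvgrPdist_lt/(_ _ del0)[n _ hn]].
have [/= + _] := he n; apply; rewrite ltW//.
apply: le_lt_trans (hn n (leqnn n)); rewrite !sub0r !normrN.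
rewrite !ger0_norm ?fine_ge0// fine_le//.
- by apply: fin_num_measure.
- by apply: fin_num_measure; exact: bigcup_measurable.
apply: le_measure; rewrite ?inE//; first exact: bigcup_measurable.
by move=> w bw; exists n => //=.
Unshelve. all: by end_near. Qed.

End convergence_in_probability.

(** * From rational times to all times *)

Section dense_convergence.
Context {R : realType}.

(** Clipping puts both endpoints of [[0, T]] among these times, even for irrational [T]; an endpoint
    cannot be squeezed between two others. Indices that encode no rational default to time [0]. *)
Definition rational_time (T : R) (j : nat) : R :=
  Num.max 0 (Num.min T (ratr (odflt 0 (unpickle j)))).

Lemma rational_time_itv T j : 0 <= T -> 0 <= rational_time T j <= T.
Proof. by move=> T0; rewrite le_max lexx/= ge_max T0/= ge_min lexx. Qed.

Lemma rational_timeE T (q : rat) :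
  rational_time T (pickle q) = Num.max 0 (Num.min T (ratr q)).
Proof. by rewrite /rational_time pickleK. Qed.

Lemma rational_time_dense T a b : 0 <= a -> a < b -> b <= T ->
  exists j, a < rational_time T j < b.
Proof.
move=> a0 ab bT; have [q] := rat_in_itvoo ab.
rewrite in_itv/= => /andP[aq qb]; exists (pickle q).
rewrite rational_timeE (min_idPr _) ?(max_idPr _) ?aq//.
  exact: ltW (le_lt_trans a0 aq).
exact: ltW (lt_le_trans qb bT).
Qed.

(** Monotonicity squeezes [A n t] between its values at two rational times around [t], where [Q] is
    close to [Q t] by continuity. *)
Lemma nondecreasing_cvg_dense (T : R) (A : nat -> R -> R) (Q : R -> R) :
  0 <= T -> (forall n s t, 0 <= s -> s <= t -> A n s <= A n t) ->
  {within `[0, T], continuous Q} ->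
  (forall j, A n (rational_time T j) @[n --> \oo] --> Q (rational_time T j)) ->
  forall t, 0 <= t <= T -> A n t @[n --> \oo] --> Q t.
Proof.
move=> T0 ndA cQ AQ t /andP[t0 tT].
have [->|tn0] := eqVneq t 0.
  have := AQ (pickle (0 : rat)).
  by rewrite rational_timeE rmorph0 (min_idPr T0) (max_idPr _).
have [->|tnT] := eqVneq t T.
  have [q] : exists q : rat, ratr q \in `]T, T + 1[.
    by apply: rat_in_itvoo; rewrite ltrDl.
  rewrite in_itv/= => /andP[Tq _]; have := AQ (pickle q).
  by rewrite rational_timeE (min_idPl (ltW Tq)) (max_idPr T0).
have {tn0} t0' : 0 < t by rewrite lt_neqAle eq_sym tn0.
have {tnT} tT' : t < T by rewrite lt_neqAle tnT.
apply/cvgrPdist_le => e e0; have e2 : 0 < e / 2 by rewrite divr_gt0.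
move/subspace_continuousP : cQ => /(_ t); rewrite /= in_itv/= t0 tT => /(_ isT).
move=> /cvgrPdist_le/(_ _ e2); rewrite near_withinE => -[r /= r0 hr].
have Qr s : 0 <= s <= T -> `|t - s| < r -> `|Q t - Q s| <= e / 2.
  by move=> sT tsr; apply: hr => //=; rewrite in_itv.
have [j1 /andP[j1a j1t]] : exists j, Num.max 0 (t - r) < rational_time T j < t.
  by apply: rational_time_dense; rewrite ?le_max ?lexx// gt_max t0' ltrBlDr ltrDl.
have [j2 /andP[tj2 j2b]] : exists j, t < rational_time T j < Num.min T (t + r).
  by apply: rational_time_dense; rewrite ?ge_min ?lexx// lt_min tT' ltrDl.
move: j1a j2b; rewrite gt_max lt_min => /andP[? j1r] /andP[_ j2r].
have Q1 := Qr _ (rational_time_itv j1 T0); have Q2 := Qr _ (rational_time_itv j2 T0).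
have {}Q1 : `|Q t - Q (rational_time T j1)| <= e / 2.
  by apply: Q1; rewrite ger0_norm; lra.
have {}Q2 : `|Q t - Q (rational_time T j2)| <= e / 2.
  by apply: Q2; rewrite ler0_norm; lra.
near=> n.
have A1 : `|Q (rational_time T j1) - A n (rational_time T j1)| <= e / 2.
  by near: n; move/cvgrPdist_le : (AQ j1); exact.
have A2 : `|Q (rational_time T j2) - A n (rational_time T j2)| <= e / 2.
  by near: n; move/cvgrPdist_le : (AQ j2); exact.
have /andP[j10 _] := rational_time_itv j1 T0.
have B1 := ndA n (rational_time T j1) t j10 (ltW j1t).
have B2 := ndA n t (rational_time T j2) t0 (ltW tj2).
move: Q1 Q2 A1 A2; rewrite !ler_norml => /andP[? ?] /andP[? ?] /andP[? ?] /andP[? ?].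
by apply/andP; split; lra.
Unshelve. all: by end_near. Qed.

End dense_convergence.

(** * The functional Ito formula *)

Section pathwise_ito.
Context {R : realType} {T : {posnum R}} {d : measure_display}
  {Om : measurableType d} (X Q : cprocess Om T) (w : Om).
Implicit Types (s t : R).
Variable u : bpath T -> R.
Hypothesis uC12 : past_present_C12 u.
Variable G : cumulative R R.
Hypothesis GQ : forall s, G s = extend Q s w.

Let xi s := extend X s w.
Let W s := bpath_of_cpath (window X s w).

Let cxi : continuous xi. Proof. exact: extend_continuous. Qed.

Lemma window_clip s : 0 <= s <= T%:num ->
  [/\ u (W s) = window_value X w u s (xi s),
      DH u (W s) = window_DH X w u s (xi s),
      DV u (W s) = window_DV X w u s (xi s) &
      DVV u (W s) = window_DVV X w u s (xi s)].
Proof.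
move=> /andP[s0 sT]; rewrite /W bpath_of_window.
rewrite /window_value /window_DH /window_DV /window_DVV.
rewrite DH_glue DV_glue DVV_glue (min_idPr sT) (max_idPr s0).
by rewrite (max_idPl _) ?mul0r ?addr0// subr_le0.
Qed.

(** The formula solved for the forward integral. No sequence of steps occurs in it, which is what
    identifies limits along different sequences. *)
Definition ito_difference t :=
  u (W t) - u (W 0) - \int[lebesgue_measure]_(s in `[0, t]) DH u (W s)
  - 2^-1 * \int[lebesgue_stieltjes_measure G]_(s in `[0, t]) DVV u (W s).

Let f s := window_DVV X w u s (xi s).
Let k s := window_DH X w u s (xi s).
Let v s := window_value X w u s (xi s).

Let cf : continuous f.
Proof. exact: (continuous_along cxi (@window_DVV_continuous _ _ _ _ X w _ uC12)). Qed.
Let ck : continuous k.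
Proof. exact: (continuous_along cxi (@window_DH_continuous _ _ _ _ X w _ uC12)). Qed.
Let cv : continuous v.
Proof. exact: (continuous_along cxi (@window_value_continuous _ _ _ _ X w _ uC12)). Qed.

Let B t := \int[lebesgue_stieltjes_measure G]_(s in `[0, t]) f s.

Let GN : G (-1) = G 0.
Proof. by rewrite !GQ !extend_le0. Qed.

Let B0 : B 0 = 0.
Proof. by apply: Rintegral_itv00; exact: lebesgue_stieltjes_set0. Qed.

Let primitive_B : primitive_wrt G f B.
Proof.
have c1 : continuous (fun _ : R => 1 : R) by move=> x; exact: cvg_cst.
have P := primitive_Rintegral (lebesgue_stieltjes_itv_fin G) cf c1 (fun=> ler01).
move=> s t c r s0 st fc; have := P s t c r s0 st fc.
rewrite !Rintegral_stieltjes_cst//; last exact: le_trans st.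
under eq_Rintegral do rewrite mulr1.
under [X in _ - X - _]eq_Rintegral do rewrite mulr1.
by rewrite (_ : G t - G 0 - (G s - G 0) = G t - G s)//; ring.
Qed.

Lemma ito_differenceE t : 0 <= t <= T%:num ->
  ito_difference t
  = v t - v 0 - \int[lebesgue_measure]_(s in `[0, t]) k s - 2^-1 * B t.
Proof.
move=> /andP[t0 tT]; rewrite /ito_difference.
have [-> _ _ _] := @window_clip t (introT andP (conj t0 tT)).
have [-> _ _ _] := @window_clip 0 (introT andP (conj (lexx 0) (ge0 T))).
have sT s : s \in `[0, t]%classic -> 0 <= s <= T%:num.
  by rewrite inE/= in_itv/= => /andP[-> /le_trans ->].
have -> : \int[lebesgue_measure]_(s in `[0, t]) DH u (W s)
    = \int[lebesgue_measure]_(s in `[0, t]) k s.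
  by apply: eq_Rintegral => s /sT /window_clip[].
have -> // : \int[lebesgue_stieltjes_measure G]_(s in `[0, t]) DVV u (W s) = B t.
by apply: eq_Rintegral => s /sT /window_clip[].
Qed.

Lemma DH_window_integrable t : t <= T%:num ->
  lebesgue_measure.-integrable `[0, t] (fun s => (DH u (W s))%:E).
Proof.
move=> tT; apply: (@eq_integrable _ _ _ lebesgue_measure _ _ (EFin \o k)) => //.
  move=> s; rewrite inE/= in_itv/= => /andP[s0 st].
  by have [|_ -> _ _] := @window_clip s; rewrite ?s0 ?(le_trans st).
exact: lebesgue_continuous_integrable.
Qed.

Lemma DVV_window_integrable t : t <= T%:num ->
  (lebesgue_stieltjes_measure G).-integrable `[0, t]
    (fun s => (DVV u (W s))%:E).
Proof.
move=> tT.
have If := continuous_integrable (lebesgue_stieltjes_itv_fin G) 0 t cf.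
have E : {in [set` `[0, t]] : set R, (EFin \o f) =1 (fun s => (DVV u (W s))%:E)}.
  move=> s; rewrite inE/= in_itv/= => /andP[s0 st].
  by have [|_ _ _ ->] := @window_clip s; rewrite ?s0 ?(le_trans st).
by apply: eq_integrable If.
Qed.

Lemma ito_difference_continuous :
  {within `[0, T%:num], continuous ito_difference}.
Proof.
pose g : R -> R := fun t =>
  v t - v 0 - \int[lebesgue_measure]_(s in `[0, t]) k s - 2^-1 * B t.
have cB (a b : R -> R) : {within `[0, T%:num], continuous a} ->
    {within `[0, T%:num], continuous b} ->
    {within `[0, T%:num], continuous (fun t => a t - b t)}.
  by move=> ca cb x; apply: continuousB; [exact: ca|exact: cb].
have cM (a b : R -> R) : {within `[0, T%:num], continuous a} ->
    {within `[0, T%:num], continuous b} ->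
    {within `[0, T%:num], continuous (fun t => a t * b t)}.
  by move=> ca cb x; apply: continuousM; [exact: ca|exact: cb].
have cG : {within `[0, T%:num], continuous G}.
  apply: continuous_subspaceT.
  by rewrite (_ : (G : R -> R) = extend Q ^~ w) ?funeqE//; exact: extend_continuous.
have cg : {within `[0, T%:num], continuous g}.
  have cc (c : R) : {within `[0, T%:num], continuous (fun _ : R => c)}.
    by apply: continuous_subspaceT => x; exact: cvg_cst.
  have cid : {within `[0, T%:num], continuous (@id R)}.
    by apply: continuous_subspaceT => x; exact: cvg_id.
  have cvT : {within `[0, T%:num], continuous v} by exact: continuous_subspaceT.
  have T0 : 0 <= T%:num by [].
  have cBT := primitive_continuous T0 cf cG primitive_B.
  have ckT := primitive_continuous T0 ck cid (primitive_lebesgue ck).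
  exact: (cB _ _ (cB _ _ (cB _ _ cvT (cc _)) ckT) (cM _ _ (cc _) cBT)).
apply: subspace_eq_continuous cg => x; rewrite inE/= in_itv/= => xT.
by rewrite /from_subspace /= ito_differenceE.
Qed.

Lemma forward_approx_cvg (e_ : nat -> R) t : 0 <= t <= T%:num ->
  e_ n @[n --> \oo] --> 0^'+ ->
  (forall s, 0 <= s <= T%:num -> qv_approx X s (e_ n) w @[n --> \oo] --> Q s w) ->
  forward_approx (fun s w => DV u (bpath_of_cpath (window X s w))) X t (e_ n) w
    @[n --> \oo] --> ito_difference t.
Proof.
move=> tT e0 eQ; rewrite ito_differenceE//.
have hh1 (s a : R) : 0 <= s <= T%:num ->
    is_derive a 1 (window_value X w u s) (window_DV X w u s a).
  move=> /andP[_ sT].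
  rewrite (_ : window_value X w u s = tilde u (past_window X w
      (Num.max 0 (Num.min T%:num s)))); last first.
    apply/funext => b; rewrite /window_value.
    rewrite (_ : Num.max 0 (s - _) = 0) ?mul0r ?addr0//.
    by apply/max_idPl; rewrite subr_le0.
  exact: is_derive_tilde.
have QG s : 0 <= s <= T%:num -> Q s w = G s.
  by move=> /andP[s0 sT]; rewrite GQ /extend (min_idPr sT) (max_idPr s0).
have /andP[t0 tT'] := tT.
have := @forward_integral_cvg R T%:num xi _ _ _ _ cxi
  (@window_value_continuous _ _ _ _ X w _ uC12)
  (@window_DH_continuous _ _ _ _ X w _ uC12)
  (@window_DV_continuous _ _ _ _ X w _ uC12)
  (@window_DVV_continuous _ _ _ _ X w _ uC12)
  (@window_value_primitive _ _ _ _ X w _ uC12)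
  hh1 (fun s a _ => @is_derive_dtilde _ _ _ uC12 _ a) e_ G B t tT e0.
have /[swap]/[apply] : forall s, 0 <= s <= t ->
    (e_ n)^-1 * \int[lebesgue_measure]_(r in `[0, s]) (xi (r + e_ n) - xi r) ^+ 2
    @[n --> \oo] --> G s.
  move=> s /andP[s0 st]; have sT : 0 <= s <= T%:num by rewrite s0 (le_trans st).
  by rewrite -QG//; exact: eQ.
move=> /(_ primitive_B B0); apply: cvg_trans; apply: near_eq_cvg.
apply: nearW => n; rewrite /forward_approx; apply: eq_Rintegral => s.
rewrite inE/= in_itv/= => /andP[s0 st].
by have [|_ _ -> _] := @window_clip s; rewrite ?s0 ?(le_trans st).
Qed.

End pathwise_ito.

(** * The quadratic variation as a Stieltjes integrator *)

Section quadratic_variation.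
Context {R : realType} {T : {posnum R}} {d : measure_display}
  {Om : measurableType d} (X Q : cprocess Om T).
Implicit Types (s t e : R) (w : Om).

Lemma qv_approx_nondecreasing e w s t : 0 <= e -> 0 <= s -> s <= t ->
  qv_approx X s e w <= qv_approx X t e w.
Proof.
move=> e0 s0 st; rewrite /qv_approx ler_wpM2l ?invr_ge0//.
have cD : continuous (fun r => (extend X (r + e) w - extend X r w) ^+ 2).
  have cxi : continuous (extend X ^~ w) by exact: extend_continuous.
  move=> r; apply: (@continuous_comp _ _ _
    (fun r => extend X (r + e) w - extend X r w) (fun x => x ^+ 2)).
    apply: cvgB; last exact: cxi.
    apply: (@continuous_comp _ _ _ (fun r => r + e) (extend X ^~ w)); last exact: cxi.
    by apply: cvgD; [exact: cvg_id|exact: cvg_cst].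
  exact: exprn_continuous.
rewrite [leRHS](Rintegral_itv_split lebesgue_itv_fin cD s0 st) lerDl.
by apply: Rintegral_ge0 => r _; exact: sqr_ge0.
Qed.

Lemma qv_approx_cvg_dense (e_ : nat -> R) w : (forall n, 0 < e_ n) ->
  (forall j, qv_approx X (rational_time T%:num j) (e_ n) w @[n --> \oo]
    --> Q (rational_time T%:num j) w) ->
  forall t, 0 <= t <= T%:num -> qv_approx X t (e_ n) w @[n --> \oo] --> Q t w.
Proof.
move=> e0 h.
apply: (@nondecreasing_cvg_dense _ _ (fun n t => qv_approx X t (e_ n) w)) => //.
  by move=> n s t s0 st; apply: qv_approx_nondecreasing => //; exact: ltW.
exact: cprocess_continuous.
Qed.

(** A limit of nondecreasing functions is nondecreasing, so [Q] defines a Stieltjes measure for each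
    outcome at which the approximations converge. *)
Lemma quadratic_variation_cumulative (e_ : nat -> R) w : (forall n, 0 < e_ n) ->
  (forall t, 0 <= t <= T%:num -> qv_approx X t (e_ n) w @[n --> \oo] --> Q t w) ->
  exists G : cumulative R R, forall s, G s = extend Q s w.
Proof.
move=> e0 h; pose g s := extend Q s w.
have clip s : 0 <= Num.max 0 (Num.min T%:num s) <= T%:num.
  by rewrite le_max lexx/= ge_max ge0/= ge_min lexx.
have ndg : {homo g : x y / x <= y}.
  move=> x y xy; rewrite /g /extend.
  apply: (ler_cvg_to (h _ (clip x)) (h _ (clip y))); apply: nearW => n.
  have /andP[cx _] := clip x.
  apply: qv_approx_nondecreasing => //; first exact: ltW.
  rewrite ge_max le_max lexx/= le_max ge_min; apply/orP; right.
  by rewrite le_min !ge_min lexx xy orbT.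
have rcg : right_continuous g.
  by apply: right_continuousW; exact: extend_continuous.
pose Gm := isCumulative.Build R _ R g ndg rcg.
pose G : cumulative R R := HB.pack g Gm.
by exists G.
Qed.

End quadratic_variation.

Theorem theorem2p25 (R : realType) (T : {posnum R}) (U : cpath T -> R)
    (d : measure_display) (Om : measurableType d) (P : probability Om R)
    (X Q : cprocess Om T) :
  C12 U -> is_quadratic_variation P X Q ->
  exists2 J : cprocess Om T,
    is_forward_integral P (fun s w => cDV U (window X s w)) X J &
    {ae P, forall w, exists2 G : cumulative R R,
      (forall s, G s = extend Q s w) &
      forall t, t \in `[0, T%:num] ->
      [/\ lebesgue_measure.-integrable `[0, t]
            (fun s => (cDH U (window X s w))%:E),
          (lebesgue_stieltjes_measure G).-integrable `[0, t]
            (fun s => (cDVV U (window X s w))%:E) &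
          U (window X t w) =
            U (window X 0 w)
            + \int[lebesgue_measure]_(s in `[0, t]) cDH U (window X s w)
            + J t w
            + 2^-1 * \int[lebesgue_stieltjes_measure G]_(s in `[0, t])
                        cDVV U (window X s w)]}.
Proof.
move=> HU HQ.
have [uC12 uU] : C12_extension U (extension U).
  by have [u hu] := HU; exact: xgetI hu.
set u := extension U in uC12 uU *.
pose Y (s : R) (w : Om) := cDV U (window X s w).
have FQ j : cvg_in_probability P (qv_approx X (rational_time T%:num j))
    (Q (rational_time T%:num j)).
  by apply: HQ; rewrite in_itv/=; apply: rational_time_itv.
have sub S := @cvg_in_probability_subsequence _ _ _ P _ _ S FQ.
(* Taking [S = setT] fixes the reference sequence and the null set [N] off which the formula will
   hold. *)
have [|e_ [/all_and2[_ e_gt0] e_0] [N [mN N0 hN]]] := sub setT.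
  by move=> A hA; near (0:R)^'+ => e; exists e => //; near: e.
have hNt w : ~ N w -> forall t, 0 <= t <= T%:num ->
    qv_approx X t (e_ n) w @[n --> \oo] --> Q t w.
  by move=> /hN h; exact: qv_approx_cvg_dense.
have hG w : ~ N w -> exists G : cumulative R R, forall s, G s = extend Q s w.
  by move=> /hNt h; exact: quadratic_variation_cumulative h.
have cX w : continuous (extend X ^~ w) by exact: extend_continuous.
have cY w : continuous (Y ^~ w).
  have := @continuous_along _ _ (cX w)
    (fun s a => DV u (glue (past_window X w s) a))
    (@continuous_glue_window _ _ _ _ X w _ (@C12_DV_continuous _ _ _ uC12)).
  by under eq_fun do rewrite -bpath_of_window.
have mY s : measurable_fun setT (Y s).
  exact: (window_functional_measurable X s (@C12_DV_continuous _ _ _ uC12)).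
have mF t e : 0 <= t -> measurable_fun setT (forward_approx Y X t e).
  move=> t0; apply: Rintegral_continuous_measurable => // [s|w s].
    apply: measurable_funM; first exact: mY.
    apply: measurable_funM; last exact: measurable_cst.
    by apply: measurable_funB; exact: extend_measurable.
  apply: cvgM; first exact: cY.
  apply: cvgM; last exact: cvg_cst.
  apply: cvgB; last exact: cX.
  apply: (@continuous_comp _ _ _ (fun s => s + e) (extend X ^~ w)); last exact: cX.
  by apply: cvgD; [exact: cvg_id|exact: cvg_cst].
(* Defining the integral as a limit along one sequence makes it measurable in
   [w]; its continuity in [t] follows from the formula itself. *)
pose J0 t w := if pselect (N w) then 0
  else lim (forward_approx Y X t (e_ n) w @[n --> \oo]).
have J0N t w : N w -> J0 t w = 0 by rewrite /J0; case: pselect.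
have J0E w (G : cumulative R R) : ~ N w -> (forall s, G s = extend Q s w) ->
    forall t, 0 <= t <= T%:num -> J0 t w = ito_difference X w u G t.
  move=> nNw GQ t tT; rewrite /J0; case: pselect => //= nNw'.
  have L := @forward_approx_cvg _ _ _ _ X Q w u uC12 G GQ e_ t tT e_0 (hNt w nNw).
  exact: (cvg_lim _ L).
have mJ t : t \in `[0, T%:num] -> measurable_fun setT (J0 t).
  rewrite in_itv/= => tT; have /andP[t0 _] := tT.
  (* The indicator makes the sequence converge for every outcome, with the default value [0] on
     [N]. *)
  apply: (@measurable_fun_cvg _ _ _ _
    (fun n w => forward_approx Y X t (e_ n) w * \1_(~` N) w)).
    move=> n; apply: measurable_funM; first exact: mF.
    by apply: measurable_indic; exact: measurableC.
  move=> w _; have [Nw|nNw] := pselect (N w).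
    rewrite J0N//; apply: cvg_near_cst; apply: nearW => n.
    by rewrite indicE memNset ?mulr0//= => /(_ Nw).
  have [G GQ] := hG w nNw; rewrite (J0E w G)//.
  under eq_fun do rewrite indicE mem_set// mulr1.
  exact: (@forward_approx_cvg _ _ _ _ X Q w u uC12 G GQ e_ t tT e_0 (hNt w nNw)).
have cJ w : {within `[0, T%:num], continuous (J0 ^~ w)}.
  have [Nw|nNw] := pselect (N w).
    rewrite (_ : J0 ^~ w = fun=> 0); last by apply/funext => t; rewrite J0N.
    by apply: continuous_subspaceT => t; exact: cvg_cst.
  have [G GQ] := hG w nNw.
  apply: subspace_eq_continuous (ito_difference_continuous uC12 GQ).
  by move=> x; rewrite inE/= in_itv/= => xT; rewrite /from_subspace /= (J0E w G).
pose J := CProcess mJ cJ.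
exists J.
  split=> [t _|| t]; first exact: mY.
    apply: aeW => w; apply: lebesgue_continuous_integrable; exact: cY.
  rewrite in_itv/= => tT; have /andP[t0 tT'] := tT.
  apply: cvg_in_probability_ae => [e e0||S S0].
  - exact: mF.
  - by apply: (mJ); rewrite in_itv.
  (* Along a sequence inside the arbitrary [S] the limit is again [ito_difference], hence equals
     [J0], although [J0] was built from [e_]. *)
  have [e'_ [e'S e'_0] [N' [mN' N'0 hN']]] := sub S S0.
  exists e'_ => //; exists (N `|` N'); split.
  - exact: measurableU.
  - exact: null_set_setU.
  move=> w /not_orP[nNw nN'w]; have [G GQ] := hG w nNw.
  have L := @forward_approx_cvg _ _ _ _ X Q w u uC12 G GQ e'_ t tT e'_0.
  rewrite -(J0E w G nNw GQ t tT) in L; apply: L.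
  by apply: qv_approx_cvg_dense => [n|]; [have [] := e'S n|exact: hN'].
exists N; split => // w; apply: contra_notP => nNw.
have [G GQ] := hG w nNw; exists G => // t; rewrite in_itv/= => tT.
have /andP[t0 tT'] := tT.
split.
- exact: (@DH_window_integrable _ _ _ _ X w u uC12 t tT').
- exact: (@DVV_window_integrable _ _ _ _ X w u uC12 G t tT').
rewrite (J0E w G nNw GQ t tT) /ito_difference !uU.
rewrite /cDH /cDVV -/u; set a := Rintegral _ _ _; set b := Rintegral _ _ _.
by ring.
Unshelve. all: by end_near.
Qed.
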